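(* Let $G$ be an even Hamiltonian graph and let $H$ be a graph. If $H$ is 2-connected, then the exponential graph $G^{H^2}$ is Hamiltonian. If $H$ is connected, then the exponential graph $G^{H^3}$ is Hamiltonian. Here $H^2$ and $H^3$ denote the square and the cube (second and third powers) of $H$.
   Context: A graph means a finite simple undirected graph with at least one vertex. A graph is even if it has an even number of vertices. A cycle has length at least 3; a Hamiltonian cycle is a cycle containing every vertex, and a graph is Hamiltonian if it has a Hamiltonian cycle. A graph $H$ is 2-connected if $\kappa(H)\ge 2$, where the connectivity $\kappa(H)$ is the minimum number of vertices whose removal results in a disconnected graph or a graph with one vertex. For a positive integer $n$, the $n$-th power $H^n$ of a graph $H$ has vertex set $V(H)$, with two distinct vertices $u,v$ adjacent if and only if their distance in $H$ is at most $n$. Exponential graph: for graphs $G$ and $H$ with $V(H)=\{w_1,\ldots,w_q\}$, the exponential graph $G^H$ has vertex set $\{(u_1,\ldots,u_q;w_j) : u_i\in V(G)\ (1\le i\le q),\ 1\le j\le q\}$, and two vertices $(u_1,\ldots,u_q;w_j)$ and $(v_1,\ldots,v_q;w_k)$ are adjacent if and only if either ($j=k$, $u_jv_j\in E(G)$, and $u_i=v_i$ for all $i\ne j$) or ($j\neq k$, $w_jw_k\in E(H)$, and $u_i=v_i$ for all $i$). In $G^{H^2}$ and $G^{H^3}$ the exponent is the power graph $H^2$, respectively $H^3$. *)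

(* Defs.v *)
From mathcomp Require Import all_boot.

Set Implicit Arguments.
Unset Strict Implicit.
Unset Printing Implicit Defensive.

Record sgraph := SGraph {
  vertex :> finType;
  adj : rel vertex;
  adj_sym : symmetric adj;
  adj_irrefl : irreflexive adj;
  vertex_gt0 : 0 < #|vertex| }.

Definition even_graph (G : sgraph) : bool := ~~ odd #|G|.

(* [ucycle] does not exclude cycles on one or two vertices: for a symmetric
   relation an edge traversed back and forth is a [ucycle], hence the bound on
   [size c]. *)
Definition hamiltonian_cycle (G : sgraph) (c : seq G) : Prop :=
  [/\ 2 < size c, ucycle (@adj G) c & forall x : G, x \in c].

Definition hamiltonian (G : sgraph) : Prop :=
  exists c : seq G, hamiltonian_cycle c.

(* Connectedness of the subgraph of G induced by A. *)
Definition connected_in (G : sgraph) (A : {set G}) : bool :=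
  [forall x in A, forall y in A, connect [rel u v in A | adj u v] x y].

Definition connected (G : sgraph) : bool := connected_in [set: G].

(* Removing S leaves a disconnected graph or a graph with one vertex. *)
Definition disconnecting (G : sgraph) (S : {set G}) : bool :=
  ~~ connected_in (~: S) || (#|~: S| == 1).

Lemma ex_disconnecting (G : sgraph) :
  exists k, [exists S : {set G}, disconnecting S && (#|S| == k)].
Proof.
have /card_gt0P[x _] := vertex_gt0 G.
exists #|~: [set x]|; apply/existsP; exists (~: [set x]).
by rewrite /disconnecting setCK cards1 eqxx orbT eqxx.
Qed.

Definition connectivity (G : sgraph) : nat := ex_minn (ex_disconnecting G).

Definition two_connected (G : sgraph) : bool := 2 <= connectivity G.

(* The tuple p lists the vertices after x, so its size k is the number of
   edges of the path. *)
Definition has_path (G : sgraph) (x y : G) (k : nat) : bool :=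
  [exists p : k.-tuple G,
    [&& path (@adj G) x p, uniq (x :: p) & last x p == y]].

Lemma ex_has_path (G : sgraph) (x y : G) :
  connect (@adj G) x y -> exists k, has_path x y k.
Proof.
case/connectP=> p xp ->; case/shortenP: xp => q xq uq _.
exists (size q); apply/existsP; exists (in_tuple q).
by rewrite /= xq eqxx andbT.
Qed.

(* [None] is the infinite distance between vertices in distinct components. *)
Definition dist (G : sgraph) (x y : G) : option nat :=
  if decP (@idP (connect (@adj G) x y)) is left xy
  then Some (ex_minn (ex_has_path xy)) else None.

Definition dist_le (G : sgraph) (n : nat) (x y : G) : bool :=
  if dist x y is Some d then d <= n else false.

Lemma has_path_sym (G : sgraph) (x y : G) k : has_path x y k -> has_path y x k.
Proof.
case/existsP=> p /and3P[xp up /eqP lp].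
have szp : size (rev (belast x p)) == k.
  by rewrite size_rev size_belast size_tuple.
apply/existsP; exists (Tuple szp).
have E : y :: rev (belast x p) = rev (x :: p).
  by rewrite [x :: p]lastI rev_rcons lp.
apply/and3P; split.
- rewrite -lp /= rev_path (eq_path (e' := @adj G)) // => u v.
  exact: adj_sym.
- by rewrite E rev_uniq.
- have <- : last y (y :: rev (belast x p)) = last y (rev (belast x p)) by [].
  by rewrite E rev_cons last_rcons.
Qed.

Lemma dist_sym (G : sgraph) (x y : G) : dist x y = dist y x.
Proof.
rewrite /dist.
have C : connect (@adj G) x y = connect (@adj G) y x.
  exact: (sym_connect_sym (@adj_sym G)).
case: (decP (@idP (connect (@adj G) x y))) => cxy;
case: (decP (@idP (connect (@adj G) y x))) => cyx //.
- case: ex_minnP => m Pm minm; case: ex_minnP => n Pn minn.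
  congr Some; apply/eqP; rewrite eqn_leq.
  by rewrite minm ?minn //; apply: has_path_sym.
- by case: cyx; rewrite -C.
- by case: cxy; rewrite C.
Qed.

Section Power.
Variables (H : sgraph) (n : nat).

Definition power_adj : rel H := [rel x y | (x != y) && dist_le n x y].

Lemma power_adj_sym : symmetric power_adj.
Proof. by move=> x y; rewrite /power_adj /= /dist_le eq_sym dist_sym. Qed.

Lemma power_adj_irrefl : irreflexive power_adj.
Proof. by move=> x; rewrite /power_adj /= eqxx. Qed.

Definition power_graph : sgraph :=
  SGraph power_adj_sym power_adj_irrefl (vertex_gt0 H).

End Power.

Section Exponential.
Variables G H : sgraph.

(* A tuple (u_1, ..., u_q) indexed by V(H) = {w_1, ..., w_q} is a function
   from V(H) to V(G). *)
Definition exp_vertex : finType := ({ffun H -> G} * H)%type.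

Definition exp_adj (a b : {ffun H -> G} * H) : bool :=
     [&& a.2 == b.2, adj (a.1 a.2) (b.1 a.2)
       & [forall i, (i != a.2) ==> (a.1 i == b.1 i)]]
  || [&& a.2 != b.2, adj a.2 b.2 & [forall i, a.1 i == b.1 i]].

Lemma exp_adj_sym : symmetric exp_adj.
Proof.
move=> [u j] [v k]; rewrite /exp_adj /= (eq_sym k) (adj_sym k).
have E : [forall i, u i == v i] = [forall i, v i == u i].
  by apply: eq_forallb => i; rewrite eq_sym.
rewrite E; case: eqP => [->|_] //=; rewrite (adj_sym (v k)) !orbF.
by congr (_ && _); apply: eq_forallb => i; rewrite (eq_sym (u i)).
Qed.

Lemma exp_adj_irrefl : irreflexive exp_adj.
Proof. by move=> [u j]; rewrite /exp_adj /= eqxx adj_irrefl. Qed.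

Lemma exp_vertex_gt0 : 0 < #|exp_vertex|.
Proof. by rewrite card_prod card_ffun muln_gt0 expn_gt0 !vertex_gt0. Qed.

Definition exp_graph : sgraph :=
  SGraph exp_adj_sym exp_adj_irrefl exp_vertex_gt0.

End Exponential.

(* Main.v *)
(** Fleischner's theorem, H^2 is Hamiltonian for a 2-connected H, is proved by
    induction on H: choose a cycle C through a prescribed vertex that contains
    another vertex y with all its neighbours on C; contract everything outside
    a component D of H - C to one vertex, apply induction, and cut the result
    into paths of the square that cover D and are attached to C at their ends;
    finally sweep along C, inserting these paths, while y lets the sweep
    turn around when all of them are closed. The induction also makes both
    neighbours of the prescribed vertex on the cycle adjacent to it in H.

    For a connected H, the cube has a Hamiltonian path by Sekanina's argument.

    In both cases the exponent has a Hamiltonian path, and since deleting edges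
    of the exponent deletes edges of the exponential graph, it remains to treat
    a path as exponent and an even cycle C_q as base. Adding a leaf to the
    exponent replaces the current graph by q copies of it, together with a new
    q-cycle for each vertex whose second component is the old end of the path.
    Starting with q parallel copies of a Hamiltonian cycle and all the new
    q-cycles, exchange edges between copies and q-cycles so that every vertex
    keeps degree 2 and the whole becomes connected. For this the Hamiltonian
    cycle must match the attachment vertices in adjacent pairs, a property which
    the new cycle inherits because q is even. *)
Require Import Defs.
From mathcomp Require Import all_boot zify.

Set Implicit Arguments.
Unset Strict Implicit.
Unset Printing Implicit Defensive.

(** At a vertex of a Hamiltonian cycle of the square no edge of [H] need be used; a cycle cut there
    would leave path ends that are not next to C. So the induction prescribes a vertex, in the role
    of the contracted one, and demands edges of the graph itself on both sides of it. If all
    inserted paths are closed, the sweep visits each vertex of C just before or just after the path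
    hanging at it. Both ends of the result must be next to the prescribed vertex, so the order has
    to change on the way, which is possible at a vertex without a path, such as y. An exchange at a
    matched pair removes the copies d and d + 1 of its edge and the edge {d, d + 1} of its two new
    cycles; these then link the copies on either side of the pair. It changes the parity of the
    number of cycles. Every pair must make one, or its new cycles stay apart; as q and the number of
    pairs are even, one exchange at each pair cannot end with a single cycle, so the last pair makes
    two. The scheme takes at least q pairs. A single vertex as exponent would provide only q / 2, so
    the first leaf has a construction of its own, after which there are at least q^2 / 2 pairs. *)

(** Coverings are stated as [perm_eq] and compared by [count] for an arbitrary predicate; the counts
    are then variables of linear arithmetic. *)
Ltac count_lia :=
  repeat match goal with
  | |- context [count ?p ?s] => let n := fresh in set n := (count p s); clearbody n
  | |- context [nat_of_bool ?b] => let n := fresh in set n := (nat_of_bool b); clearbody n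
  end; clear; lia.

(** * Conditions on the ends of a sequence *)

Section Ends.
Variable T : eqType.
Implicit Types (P Q : pred T) (s t : seq T).

(** True on the empty sequence, so that an absent closed trail satisfies the attachment
    conditions. *)
Definition fstP P s := if s is x :: _ then P x else true.
Definition lstP P s := fstP P (rev s).

Lemma fstP_sub P Q s : (forall x, P x -> Q x) -> fstP P s -> fstP Q s.
Proof. by case: s => //= x s PQ; apply: PQ. Qed.

Lemma lstP_sub P Q s : (forall x, P x -> Q x) -> lstP P s -> lstP Q s.
Proof. exact: fstP_sub. Qed.

Lemma fstP_rev P s : fstP P (rev s) = lstP P s. Proof. by []. Qed.

Lemma lstP_rev P s : lstP P (rev s) = fstP P s.
Proof. by rewrite /lstP revK. Qed.

Lemma fstP_cat P s t : fstP P (s ++ t) = if s is [::] then fstP P t else fstP P s.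
Proof. by case: s. Qed.

Lemma lstP_cat P s t : lstP P (s ++ t) = if t is [::] then lstP P s else lstP P t.
Proof.
case: t => [|y t]; first by rewrite cats0.
by rewrite /lstP rev_cat [y :: t]lastI rev_rcons.
Qed.

Lemma fstP_catl P s t : s != [::] -> fstP P (s ++ t) = fstP P s.
Proof. by case: s. Qed.

Lemma lstP_catr P s t : t != [::] -> lstP P (s ++ t) = lstP P t.
Proof. by rewrite lstP_cat; case: t. Qed.

Lemma lstP_rcons P s x : lstP P (rcons s x) = P x.
Proof. by rewrite /lstP rev_rcons. Qed.

Lemma lstP_last P x s : lstP P (x :: s) = P (last x s).
Proof. by rewrite lastI lstP_rcons. Qed.

Lemma sorted_cat (r : rel T) s t : sorted r s -> sorted r t ->
  lstP (fun a => fstP (r a) t) s -> sorted r (s ++ t).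
Proof.
case: s => [|x s] //=; rewrite lstP_last cat_path => -> /=.
by case: t => //= y t -> ->.
Qed.

Lemma sorted_rev (r : rel T) s : symmetric r -> sorted r (rev s) = sorted r s.
Proof.
move=> r_sym; rewrite rev_sorted; case: s => //= x s.
by apply: eq_path => a b; rewrite r_sym.
Qed.

End Ends.

(** * Inserting paths of the square into a cycle *)

Section Square.
Variables (T : finType) (e : rel T) (S : {set T}).
Hypothesis e_sym : symmetric e.

(** The middle vertex is taken in [S] because the induction runs over induced subgraphs of a fixed
    type. Pairs [sq a a] do no harm: repetitions are excluded by the [perm_eq] conditions. *)
Definition sq : rel T := [rel a b | e a b || [exists w in S, e a w && e w b]].

Lemma sq_sym : symmetric sq.
Proof.
move=> a b; rewrite /sq /= e_sym; congr (_ || _).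
by apply: eq_existsb => w; rewrite (andbC (e a w)) (e_sym w b) (e_sym a w).
Qed.

Lemma sq_adj a b : e a b -> sq a b. Proof. by rewrite /sq /= => ->. Qed.

Lemma sq_via w a b : w \in S -> e a w -> e w b -> sq a b.
Proof.
move=> wS aw wb; rewrite /sq /=; apply/orP; right; apply/existsP; exists w.
by rewrite wS aw.
Qed.

(* A trail [(l, s, r)]: the path [s] of the square is attached at [l] by its
   first vertex and at [r] by its last vertex. *)
Definition trail_ok (tr : T * seq T * T) :=
  [&& tr.1.2 != [::], sorted sq tr.1.2, fstP (e tr.1.1) tr.1.2
    & lstP (e tr.2) tr.1.2].

Definition ends (O : seq (T * seq T * T)) :=
  flatten [seq [:: tr.1.1; tr.2] | tr <- O].

Definition inner (O : seq (T * seq T * T)) := flatten [seq tr.1.2 | tr <- O].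

Lemma trail_rev l s r : trail_ok (l, s, r) -> trail_ok (r, rev s, l).
Proof.
case/and4P=> /= s0 ss fs ls; apply/and4P; split=> /=.
- by rewrite -size_eq0 size_rev size_eq0.
- by rewrite (sorted_rev _ sq_sym).
- by [].
- by rewrite lstP_rev.
Qed.

Lemma ends_cons tr O : ends (tr :: O) = [:: tr.1.1, tr.2 & ends O].
Proof. by []. Qed.

Lemma ends_nil : ends [::] = [::]. Proof. by []. Qed.

Lemma inner_nil : inner [::] = [::]. Proof. by []. Qed.

Lemma inner_cons tr O : inner (tr :: O) = tr.1.2 ++ inner O.
Proof. by []. Qed.

#[local] Opaque ends inner.

Lemma size_ends O : size (ends O) = (size O).*2.
Proof. by elim: O => // tr O IH; rewrite ends_cons [size (_ :: _)]/= IH. Qed.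

(** Trails have no direction: reversing one lets either end come first, so that the sweep can pull
    out a trail by the end it has reached. *)
Lemma orient O w : all trail_ok O -> w \in ends O ->
  exists s r O', [/\ trail_ok (w, s, r), all trail_ok O',
    perm_eq (ends O) (w :: r :: ends O'), perm_eq (inner O) (s ++ inner O')
    & size O = (size O').+1].
Proof.
elim: O => // -[[l s] r] O IH /andP[tok Ook].
rewrite ends_cons inner_cons !inE.
case/or3P=> [/eqP->|/eqP->|wO].
- by exists s, r, O; split.
- exists (rev s), l, O; split=> //; first exact: trail_rev.
  + by apply/permP=> p /=; count_lia.
  + by apply/permP=> p; rewrite !count_cat count_rev.
have [s' [r' [O' [ok' Ook' pe pi sz]]]] := IH Ook wO.
exists s', r', ((l, s, r) :: O'); split=> //; first by rewrite /= tok.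
- apply/permP=> p; have /permP/(_ p) := pe.
  by rewrite ends_cons /= => ->; count_lia.
- apply/permP=> p; have /permP/(_ p) := pi.
  by rewrite inner_cons !count_cat => ->; rewrite /=; count_lia.
- by rewrite /= sz.
Qed.

(** * Sweeping along the cycle *)

Section Sweep.
(** [clo v] is the closed trail at [v], attached to [v] by both ends, or empty. *)
Variable clo : T -> seq T.
Hypothesis clo_sorted : forall v, sorted sq (clo v).
Hypothesis clo_fst : forall v, fstP (e v) (clo v).
Hypothesis clo_lst : forall v, lstP (e v) (clo v).

Definition thick (vs : seq T) := flatten [seq rcons (clo v) v | v <- vs].

Lemma thick_cat s t : thick (s ++ t) = thick s ++ thick t.
Proof. by rewrite /thick map_cat flatten_cat. Qed.

Lemma thick_nil : thick [::] = [::]. Proof. by []. Qed.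

Lemma thick_cons v s : thick (v :: s) = rcons (clo v) v ++ thick s.
Proof. by []. Qed.

#[local] Opaque thick.

Definition near (w : T) : pred T := [pred z | (z == w) || e w z].

Lemma near_sq w g z : w \in S -> e g w -> near w z -> sq g z.
Proof. by move=> wS gw /orP[/eqP->|]; [apply: sq_adj | apply: sq_via]. Qed.

(* Two strands run in parallel along [m]: at each vertex one of them visits the
   vertex, the other jumps over it and picks up the closed trail there. *)
Lemma strands w m : forall v X Y b, path e v (rcons m b) ->
  {subset v :: rcons m b <= S} ->
  X != [::] -> sorted sq X -> lstP (pred1 v) X -> fstP (near w) X ->
  sorted sq Y -> lstP (e v) Y -> fstP (near w) Y -> (Y == [::] -> v = w) ->
  exists A B, [/\ A != [::], B != [::], sorted sq A & sorted sq B] /\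
   [/\ fstP (near w) A, fstP (near w) B, lstP (pred1 b) A, lstP (e b) B
     & perm_eq (A ++ B) (X ++ Y ++ thick m ++ [:: b])].
Proof.
elim: m => [|u m IH] v X Y b /=.
  rewrite andbT => vb sS X0 sX lX fX sY lY fY Yw.
  have vS : v \in S by apply: sS; rewrite inE eqxx.
  exists (rcons Y b), X; split; split=> //.
  - by case: (Y).
  - rewrite -cats1; apply: sorted_cat => //=.
    by apply: lstP_sub lY => a va; apply: (sq_via vS) => //; rewrite e_sym.
  - case: Y Yw {sY lY} fY => //= Yw _; rewrite /near /= -(Yw (eqxx _)) vb.
    by rewrite orbT.
  - by rewrite lstP_rcons /= eqxx.
  - by apply: lstP_sub lX => a /eqP->; rewrite e_sym.
  - by apply/permP=> p; rewrite -cats1 !count_cat; count_lia.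
case/andP=> vu pm sS X0 sX lX fX sY lY fY Yw.
have vS : v \in S by apply: sS; rewrite inE eqxx.
have uS : u \in S by apply: sS; rewrite !inE eqxx orbT.
have [||||||||| A [B [AB1 [AB2 AB3 AB4 AB5 AB6]]]] :=
  IH u (rcons Y u) (X ++ clo u) b pm.
- by move=> z zm; apply: sS; rewrite inE zm orbT.
- by case: (Y).
- rewrite -cats1; apply: sorted_cat => //=.
  by apply: lstP_sub lY => a va; apply: (sq_via vS) => //; rewrite e_sym.
- by rewrite lstP_rcons /= eqxx.
- case: Y Yw {sY lY} fY => //= Yw _; rewrite /near /= -(Yw (eqxx _)) vu.
  by rewrite orbT.
- apply: sorted_cat => //; apply: lstP_sub lX => a /eqP->.
  by apply: fstP_sub (clo_fst u) => z; apply: sq_via.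
- rewrite lstP_cat; case: (clo u) (clo_lst u) => // _.
  by apply: lstP_sub lX => a /eqP->; rewrite e_sym.
- by rewrite fstP_cat; case: (X) X0 fX.
- by case: (X) X0.
exists A, B; split=> //; split=> //.
apply/permP=> p; move/permP/(_ p): AB6.
by rewrite thick_cons -!cats1 !count_cat => ->; count_lia.
Qed.

Lemma first_terminal (A : pred T) s : has A s ->
  exists m b t, [/\ s = m ++ b :: t, A b & all (predC A) m].
Proof.
elim: s => //= x s IH; have [Ax _|nAx /= /IH[m [b [t [-> Ab mA]]]]] := boolP (A x).
  by exists [::], x, s.
by exists (x :: m), b, t; split=> //=; rewrite nAx.
Qed.

Lemma adj_near w s : fstP (e w) s -> fstP (near w) s.
Proof. by apply: fstP_sub => z wz; rewrite /near /= wz orbT. Qed.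

Lemma lst_near w s : lstP (e w) s -> lstP (near w) s.
Proof. exact: adj_near. Qed.

Lemma sorted_revE s : sorted sq (rev s) = sorted sq s.
Proof. exact: (sorted_rev _ sq_sym). Qed.

(** The vertex [w] only serves as the middle of a step, so pieces can be joined at a vertex that is
    visited elsewhere. *)
Lemma glue w s t : w \in S -> sorted sq s -> sorted sq t -> lstP (e w) s ->
  fstP (near w) t -> sorted sq (s ++ t).
Proof.
move=> wS ss st ls ft; apply: sorted_cat => //.
apply: lstP_sub ls => a wa; apply: fstP_sub ft => z.
by apply: near_sq => //; rewrite e_sym.
Qed.

Lemma glue' w s t : w \in S -> sorted sq s -> sorted sq t -> lstP (near w) s ->
  fstP (e w) t -> sorted sq (s ++ t).
Proof.
move=> wS ss st ls ft; rewrite -sorted_revE rev_cat.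
by apply: (glue wS); rewrite ?sorted_revE ?lstP_rev.
Qed.

Lemma rev_neq0 (s : seq T) : (rev s == [::]) = (s == [::]).
Proof. by rewrite -!size_eq0 size_rev. Qed.

Lemma cat_eq0 (s t : seq T) : (s ++ t == [::]) = (s == [::]) && (t == [::]).
Proof. by case: s. Qed.

Lemma cat_neq0 (s t : seq T) : s != [::] -> s ++ t != [::].
Proof. by case: s. Qed.

Lemma sweep0 v Q h O a :
  Q != [::] -> sorted sq Q -> fstP (e h) Q -> lstP (pred1 v) Q ->
  uniq (h :: ends O) -> {subset h :: ends O <= [:: a]} ->
  a \in h :: ends O -> uniq [:: a] ->
  (forall w, w \in h :: ends O -> clo w = [::]) ->
  exists Q', [/\ Q' != [::], sorted sq Q', fstP (e a) Q',
    lstP (pred1 v) Q' & perm_eq Q' (Q ++ thick [::] ++ inner O)].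
Proof.
move=> Q0 sQ fQ lQ uE sE aE _ _; exists Q.
have O0 : O = [::] by have := uniq_leq_size uE sE; rewrite /= size_ends; case: (O).
move: aE; rewrite O0 ends_nil inE => /eqP->; split=> //.
by rewrite inner_nil thick_nil !cats0 perm_refl.
Qed.

(** Invariant: [Q] and the trails of [O] cover what has been passed; [Q] ends at the current vertex
    [v], and its head hangs at the terminal [h]. All the terminals [h :: ends O] lie ahead, on
    [rest] or at the target [a]. They are odd in number and [a] is one of them, so those on [rest]
    can be handled two at a time. *)
Lemma sweep n : forall rest v Q h O a, size rest <= n ->
  path e v rest -> {subset v :: rcons rest a <= S} ->
  Q != [::] -> sorted sq Q -> fstP (e h) Q -> lstP (pred1 v) Q ->
  all trail_ok O -> uniq (h :: ends O) -> {subset h :: ends O <= rcons rest a} ->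
  a \in h :: ends O -> uniq (rcons rest a) ->
  (forall w, w \in h :: ends O -> clo w = [::]) ->
  exists Q', [/\ Q' != [::], sorted sq Q', fstP (e a) Q',
    lstP (pred1 (last v rest)) Q' & perm_eq Q' (Q ++ thick rest ++ inner O)].
Proof.
elim: n => [|n IH] [|w rest] v Q h O a.
- move=> _ _ _ Q0 sQ fQ lQ _; exact: sweep0.
- by [].
- move=> _ _ _ Q0 sQ fQ lQ _; exact: sweep0.
move=> szr /= /andP[vw pr] sS Q0 sQ fQ lQ Ook uE sE aE ur cE.
have vS : v \in S by apply: sS; rewrite inE eqxx.
have wS : w \in S by apply: sS; rewrite !inE eqxx orbT.
have lQw : lstP (e w) Q by apply: lstP_sub lQ => z /eqP->; rewrite e_sym.
have [wE|wE] := boolP (w \in h :: ends O); last first.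
  have [|||||||||||Q' [Q'1 Q'2 Q'3 Q'4 Q'5]] :=
    IH rest w (Q ++ rcons (clo w) w) h O a szr pr.
  - by move=> z zr; apply: sS; rewrite inE zr orbT.
  - exact: cat_neq0.
  - apply: (glue wS) => //.
      rewrite -cats1; apply: sorted_cat => //=.
      by apply: lstP_sub (clo_lst w) => z wz; apply: sq_adj; rewrite e_sym.
    case: (clo w) (clo_fst w) => [|z c] /=; first by rewrite /near /= eqxx.
    by rewrite /near /= => ->; rewrite orbT.
  - by rewrite fstP_catl.
  - by rewrite lstP_catr -?size_eq0 ?size_rcons // lstP_rcons /= eqxx.
  - by [].
  - by [].
  - move=> z zE; have := sE z zE; rewrite inE => /orP[/eqP zw|//].
    by rewrite -zw zE in wE.
  - by [].
  - by case/andP: ur.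
  - by [].
  exists Q'; split=> //; apply: perm_trans Q'5 _.
  by rewrite thick_cons -!catA perm_refl.
have wa : w != a.
  by apply: contraTneq ur => ->; rewrite mem_rcons inE eqxx.
(* Otherwise the terminals would be just [w] and [a], whereas their number is [1 + 2 * size O]. *)
have /first_terminal[m [b [rest2 [Er bE mE]]]] : has (mem (h :: ends O)) rest.
  apply: contraT => /hasPn hr.
  have : perm_eq (h :: ends O) [:: w; a].
    apply: uniq_perm => //=; first by rewrite inE wa.
    move=> z; apply/idP/idP; last by rewrite !inE => /orP[] /eqP->.
    move=> zE; have := sE z zE; rewrite !inE mem_rcons inE.
    case/or3P=> [->|->|zr]; rewrite ?orbT //.
    by have := hr z zr; rewrite /= zE.
  by move/perm_size; rewrite /= size_ends; count_lia.
have Hsub z : z \in h :: ends O -> z != w -> z != b -> z \in rcons rest2 a.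
  move=> zE zw zb; have := sE z zE.
  rewrite inE (negPf zw) /= Er rcons_cat mem_cat inE (negPf zb) /=.
  by case/orP=> // zm; have /allP/(_ z zm) := mE; rewrite /= zE.
have bS : b \in S.
  by apply: sS; rewrite !inE mem_rcons inE Er mem_cat inE eqxx !orbT.
have wb : w != b.
  by apply: contraTneq ur => ->; rewrite mem_rcons inE Er mem_cat inE eqxx !orbT.
have {pr}[pm pr2] : path e w (rcons m b) /\ path e b rest2.
  by move: pr; rewrite Er -cat_rcons cat_path last_rcons => /andP[].
have lst2 : last w rest = last b rest2 by rewrite Er last_cat.
have ur2 : uniq (rcons rest2 a).
  by move: ur; rewrite Er rcons_cat cat_uniq /= => /and4P[_ _ _ /andP[]].
have sz2 : size rest2 <= n by move: szr; rewrite Er /= size_cat /=; clear; lia.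
have sS2 : {subset b :: rcons rest2 a <= S}.
  move=> z; rewrite inE => /orP[/eqP->//|zr]; apply: sS.
  by rewrite Er rcons_cat !inE mem_cat inE zr !orbT.
have thE : thick (w :: rest) = [:: w] ++ thick m ++ [:: b] ++ thick rest2.
  by rewrite thick_cons Er thick_cat thick_cons !cE.
(* Two strands lead from [w] to [b]: [A] takes the path on to [b], and [B] joins something hanging
   at [w] to something hanging at [b]. *)
have [|||||||||A [B [[A0 B0 sA sB] [fA fB lA lB pAB]]]] :=
  @strands w m w [:: w] [::] b pm.
- move=> z zm; apply: sS.
  move: zm; rewrite Er !inE !mem_rcons !inE mem_cat inE.
  by case/or3P=> ->; rewrite ?orbT.
- by [].
- by [].
- by rewrite /lstP /= eqxx.
- by rewrite /= /near /= eqxx.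
- by [].
- by [].
- by [].
- by [].
have {}pAB p : count p A + count p B = p w + count p (thick m) + p b.
  by move/permP/(_ p): pAB; rewrite !count_cat /=; count_lia.
have lAb : lstP (pred1 b) (rcons A b) by rewrite lstP_rcons /= eqxx.
(* The terminals [w] and [b] are used up, and the sweep resumes at [b] with the head at [h'] and the
   trails [O']. *)
have finish Q' h' O' : Q' != [::] -> sorted sq Q' -> fstP (e h') Q' ->
    lstP (pred1 b) Q' -> all trail_ok O' ->
    perm_eq (h :: ends O) (w :: b :: h' :: ends O') ->
    (forall p, count p Q' + count p (inner O') =
       count p Q + count p (inner O) + count p A + count p B) ->
    exists Q', [/\ Q' != [::], sorted sq Q', fstP (e a) Q',
    lstP (pred1 (last w rest)) Q'
    & perm_eq Q' (Q ++ thick (w :: rest) ++ inner O)].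
  move=> Q'0 sQ' fQ' lQ' Ook' pE cQ.
  have uE' : uniq (w :: b :: h' :: ends O') by rewrite -(perm_uniq pE).
  have sE' z : z \in h' :: ends O' -> z \in h :: ends O.
    by rewrite (perm_mem pE) => zE; rewrite 2!inE zE !orbT.
  have [|||||Q2 [Q20 sQ2 fQ2 lQ2 pQ2]] :=
    IH rest2 b Q' h' O' a sz2 pr2 sS2 Q'0 sQ' fQ' lQ' Ook'.
  - by case/and3P: uE'.
  - move=> z zE; apply: Hsub; first exact: sE'.
    + by apply: contraTneq uE' => <-; rewrite [uniq _]/= inE zE orbT.
    + by apply: contraTneq uE' => <-; rewrite [uniq _]/= zE andbF.
  - move: aE; rewrite (perm_mem pE) 2!inE eq_sym (negPf wa) /=.
    case/orP=> // /eqP ab; move: ur; rewrite ab Er => /andP[_].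
    by rewrite rcons_uniq mem_cat inE eqxx !orbT.
  - by [].
  - by move=> z zE; apply/cE/sE'.
  exists Q2; split=> //; first by rewrite lst2.
  apply/permP=> p; move/permP/(_ p): pQ2 => ->.
  by rewrite thE !count_cat /=; move: (cQ p) (pAB p); count_lia.
have adjb s : fstP (e b) s -> fstP (near b) s by exact: adj_near.
(* If [w = h], the strand [B] carries the head of [Q] over to [b], and the trail found there moves
   it on to its other end [r]. *)
move: wE; rewrite inE => /orP[/eqP wh|wO].
  have bO : b \in ends O.
    by move: bE; rewrite /= inE -wh eq_sym (negPf wb).
  have [s [r [O' [tok Ook' pe pi _]]]] := orient Ook bO.
  case/and4P: tok => /= s0 ss fs ls.
  apply: (finish (rev s ++ rev B ++ Q ++ A) r O') => //.
  - by rewrite cat_neq0 // rev_neq0.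
  - apply: (glue bS); rewrite ?sorted_revE ?lstP_rev //.
      apply: (glue' wS); rewrite ?sorted_revE ?lstP_rev //.
        by apply: (glue wS).
      by rewrite fstP_catl // wh.
    by rewrite fstP_catl ?rev_neq0 // fstP_rev; apply: lst_near.
  - by rewrite fstP_catl ?rev_neq0.
  - by rewrite !lstP_catr ?cat_eq0 ?(negPf A0) ?andbF.
  - rewrite wh; apply/permP=> p; move/permP/(_ p): pe => /=; count_lia.
  - move=> p; move/permP/(_ p): pi; rewrite !count_cat !count_rev; count_lia.
have [s [r [O' [tok Ook' pe pi _]]]] := orient Ook wO.
have /and4P[/= s0 ss fs ls] := tok.
have wh : h != w by apply: contraTneq uE => ->; rewrite /= wO.
have [bh|bh] := eqVneq b h.
  apply: (finish (rev s ++ B ++ Q ++ A) r O') => //.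
  - by rewrite cat_neq0 // rev_neq0.
  - apply: (glue wS); rewrite ?sorted_revE ?lstP_rev //; last by rewrite fstP_catl.
    apply: (glue bS); rewrite ?sorted_revE //.
      by apply: (glue wS).
    by rewrite fstP_catl // bh; apply: adj_near.
  - by rewrite fstP_catl ?rev_neq0.
  - by rewrite !lstP_catr ?cat_eq0 ?(negPf A0) ?andbF.
  - rewrite bh; apply/permP=> p; move/permP/(_ p): pe => /=; count_lia.
  - move=> p; move/permP/(_ p): pi; rewrite !count_cat !count_rev; count_lia.
(* Here one trail joins [w] to [b]: the path goes ahead along [B], comes back by the trail and goes
   ahead again along [A]. *)
have [br|br] := eqVneq b r.
  apply: (finish (Q ++ B ++ rev s ++ A) h O') => //.
  - by rewrite cat_neq0.
  - apply: (glue wS) => //; last by rewrite fstP_catl.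
    apply: (glue bS) => //; last first.
      by rewrite fstP_catl ?rev_neq0 // fstP_rev br; apply: lst_near.
    by apply: (glue wS); rewrite ?sorted_revE ?lstP_rev.
  - by rewrite fstP_catl.
  - by rewrite !lstP_catr ?cat_eq0 ?(negPf A0) ?andbF.
  - rewrite br; apply/permP=> p; move/permP/(_ p): pe => /=; count_lia.
  - move=> p; move/permP/(_ p): pi; rewrite !count_cat !count_rev; count_lia.
have bO : b \in ends O'.
  have : b \in ends O by move: bE; rewrite /= inE (negPf bh).
  by rewrite (perm_mem pe) !inE eq_sym (negPf wb) (negPf br).
have [s2 [r2 [O2 [/and4P[/= s20 ss2 fs2 ls2] Ook2 pe2 pi2 _]]]] := orient Ook' bO.
(* Two different trails, at [w] and at [b], are joined by [B] into a single one. *)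
apply: (finish (Q ++ A) h ((r, rev s ++ B ++ s2, r2) :: O2)) => //.
- by rewrite cat_neq0.
- exact: (glue wS).
- by rewrite fstP_catl.
- by rewrite !lstP_catr ?cat_eq0 ?(negPf A0) ?andbF.
- rewrite /= Ook2 andbT; apply/and4P; split=> /=.
  + by rewrite cat_neq0 // rev_neq0.
  + apply: (glue wS); rewrite ?sorted_revE ?lstP_rev //; last by rewrite fstP_catl.
    by apply: (glue bS) => //; apply: adj_near.
  + by rewrite fstP_catl ?rev_neq0.
  + by rewrite !lstP_catr ?cat_eq0 ?(negPf s20) ?andbF.
- apply/permP=> p; move/permP/(_ p): pe; move/permP/(_ p): pe2.
  by rewrite ends_cons /=; count_lia.
- move=> p; move/permP/(_ p): pi; move/permP/(_ p): pi2.
  by rewrite inner_cons /= !count_cat count_rev; count_lia.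
Qed.

Lemma near_refl w : near w w. Proof. by rewrite /near /= eqxx. Qed.

Lemma thick1 v : v \in S -> sorted sq (rcons (clo v) v) /\
  fstP (near v) (rcons (clo v) v).
Proof.
move=> vS; split.
  rewrite -cats1; apply: sorted_cat => //.
  by apply: lstP_sub (clo_lst v) => z vz; apply: sq_adj; rewrite e_sym.
by case: (clo v) (clo_fst v) => [|z c] /=; rewrite /near /= ?eqxx // => ->; rewrite orbT.
Qed.

(** Reversing the path at each step puts one end on the next vertex and leaves the other next to it,
    so the path advances along [m] with both ends in front. *)
Lemma uturn m : forall v Z, path e v m -> {subset v :: m <= S} ->
  Z != [::] -> sorted sq Z -> lstP (pred1 v) Z -> fstP (near v) Z ->
  exists Z', [/\ Z' != [::], sorted sq Z', lstP (pred1 (last v m)) Z',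
    fstP (near (last v m)) Z' & perm_eq Z' (Z ++ thick m)].
Proof.
elim: m => [|u m IH] v Z /=.
  by move=> _ _ Z0 sZ lZ fZ; exists Z; rewrite thick_nil cats0.
case/andP=> vu pm sS Z0 sZ lZ fZ.
have vS : v \in S by apply: sS; rewrite inE eqxx.
have uS : u \in S by apply: sS; rewrite !inE eqxx orbT.
have lZu : lstP (e u) Z by apply: lstP_sub lZ => z /eqP->; rewrite e_sym.
have [|||||Z' [Z'0 sZ' lZ' fZ' pZ']] := IH u (rcons (rev (Z ++ clo u)) u) pm.
- by move=> z zm; apply: sS; rewrite inE zm orbT.
- by rewrite -size_eq0 size_rcons.
- rewrite -cats1; apply: (glue' vS) => //=.
    rewrite sorted_revE; apply: (glue uS) => //; exact: adj_near.
  by rewrite lstP_rev fstP_cat; case: (Z) Z0 fZ.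
- by rewrite lstP_rcons /= eqxx.
- rewrite -cats1 fstP_catl ?rev_neq0 ?cat_neq0 // fstP_rev.
  by rewrite lstP_cat; case: (clo u) (clo_lst u) => [_|z c]; apply: lst_near.
exists Z'; split=> //; apply/permP=> p; move/permP/(_ p): pZ' => ->.
by rewrite thick_cons -!cats1 !count_cat count_rev !count_cat; count_lia.
Qed.

Definition thickR (vs : seq T) := flatten [seq v :: clo v | v <- vs].

Lemma thickR_cons v s : thickR (v :: s) = (v :: clo v) ++ thickR s.
Proof. by []. Qed.

Lemma thickR_nil : thickR [::] = [::]. Proof. by []. Qed.

#[local] Opaque thickR.

Lemma thickR_ok a s : forall v, path e v (rcons s a) -> {subset v :: s <= S} ->
  sorted sq (rcons (thickR s) a) /\ fstP (e v) (rcons (thickR s) a).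
Proof.
elim: s => [|u s IH] v /=; first by rewrite andbT thickR_nil /= => va.
case/andP=> vu ps sS.
have uS : u \in S by apply: sS; rewrite !inE eqxx orbT.
have [|ss fs] := IH u ps.
  by move=> z zs; apply: sS; rewrite inE zs orbT.
split=> //.
have -> : rcons (thickR (u :: s)) a = (u :: clo u) ++ rcons (thickR s) a.
  by rewrite thickR_cons rcons_cat.
apply: (glue' uS) => //.
  rewrite -cat1s; apply: (glue' uS) => //; exact: near_refl.
rewrite -cat1s lstP_cat; case: (clo u) (clo_lst u) => [|z c]; last exact: lst_near.
by rewrite /lstP /= near_refl.
Qed.

Lemma thick_ok s : forall v Z, path e v s -> {subset v :: s <= S} ->
  Z != [::] -> sorted sq Z -> lstP (pred1 v) Z ->
  sorted sq (Z ++ thick s) /\ lstP (pred1 (last v s)) (Z ++ thick s).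
Proof.
elim: s => [|u s IH] v Z /=; first by rewrite thick_nil cats0.
case/andP=> vu ps sS Z0 sZ lZ.
have uS : u \in S by apply: sS; rewrite !inE eqxx orbT.
have [s1 f1] := thick1 uS.
rewrite thick_cons catA; apply: IH => //.
- by move=> z zs; apply: sS; rewrite inE zs orbT.
- by rewrite cat_neq0.
- by apply: (glue uS) => //; apply: lstP_sub lZ => z /eqP->; rewrite e_sym.
- by rewrite -cats1 catA cats1 lstP_rcons /= eqxx.
Qed.

Lemma thickRE s p : count p (thickR s) = count p (thick s).
Proof.
elim: s => [|v s IH]; first by rewrite thickR_nil thick_nil.
by rewrite thick_cons thickR_cons -cats1 !count_cat -IH /=; count_lia.
Qed.

Lemma combine_closed x p y : path e x p -> e (last x p) x ->
  {subset x :: p <= S} -> y \in p -> clo y = [::] ->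
  exists t, [/\ t != [::], sorted sq t, fstP (e x) t, lstP (e x) t
    & perm_eq (x :: t) (thick (x :: p))].
Proof.
move=> xp lp sS /splitPr yp cy; case: yp xp lp sS => p1 p2.
rewrite -cat_rcons cat_path last_cat last_rcons => /andP[xp1 yp2] lp sS.
have xS : x \in S by apply: sS; rewrite inE eqxx.
have sS1 : {subset x :: p1 <= S}.
  move=> z; rewrite inE => /orP[/eqP->//|z1]; apply: sS.
  by rewrite inE mem_cat mem_rcons inE z1 !orbT.
have [s1 f1] := thickR_ok xp1 sS1.
have [||||s2 l2] := @thick_ok p2 y (clo x ++ rcons (thickR p1) y) yp2.
- move=> z; rewrite inE => zy; apply: sS; rewrite inE mem_cat mem_rcons inE.
  by case/orP: zy => ->; rewrite ?orbT.
- by rewrite cat_eq0 negb_and orbC -size_eq0 size_rcons.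
- by apply: (glue' xS) => //; apply: lst_near.
- by rewrite -rcons_cat lstP_rcons /= eqxx.
exists ((clo x ++ rcons (thickR p1) y) ++ thick p2); split=> //.
- by rewrite cat_neq0 // cat_eq0 negb_and orbC -size_eq0 size_rcons.
- rewrite -catA fstP_cat; case: (clo x) (clo_fst x) => // _.
  by rewrite fstP_catl // -size_eq0 size_rcons.
- by apply: lstP_sub l2 => z /eqP->; rewrite e_sym.
apply/permP=> q; rewrite thick_cons thick_cat -!cats1 thick_cat thick_cons cy thick_nil.
by rewrite /= !count_cat thickRE /=; count_lia.
Qed.

(** Let [a] and [b] be the first two terminals. A path that turns back covers the stretch from [a]
    to [b]; it has both ends around [b], one of which goes forward while the other takes the trail
    at [b]. The sweep then has target [a]: its result has its head next to [a], where the beginning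
    of the cycle, traversed from [x] to [a], is joined on. *)
Lemma combine_open x p O : path e x p -> e (last x p) x -> uniq (x :: p) ->
  {subset x :: p <= S} -> O != [::] -> all trail_ok O -> uniq (ends O) ->
  {subset ends O <= x :: p} -> (forall w, w \in ends O -> clo w = [::]) ->
  exists t, [/\ t != [::], sorted sq t, fstP (e x) t, lstP (e x) t
    & perm_eq (x :: t) (thick (x :: p) ++ inner O)].
Proof.
move=> xp lp uxp sS O0 Ook uE sE cE.
have szE : 1 < size (ends O) by rewrite size_ends; case: (O) O0.
have /first_terminal[s1 [a [s2 [Exp aE s1E]]]] : has (mem (ends O)) (x :: p).
  by case: (ends O) szE sE => // w E _ sE; apply/hasP; exists w;
     [apply: sE | ]; rewrite /= inE eqxx.
have /first_terminal[m [b [rest [Es2 bE mE]]]] : has (mem (ends O)) s2.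
  apply: contraTT szE => /hasPn hs2; rewrite -leqNgt.
  apply: (@uniq_leq_size _ _ [:: a]) => // z zE; rewrite inE.
  have := sE z zE; rewrite Exp mem_cat inE.
  case/or3P=> // zs; last by have := hs2 z zs; rewrite /= zE.
  by have /allP/(_ z zs) := s1E; rewrite /= zE.
have [s [r [O' [tok Ook' pe pi _]]]] := orient Ook bE.
have /and4P[/= s0 ss fs ls] := tok.
have pas2 : path e a s2.
  move: Exp xp; case: s1 {s1E} => [|x' s1] [-> ->] //=.
  by rewrite cat_path /= => /and3P[].
have la : last x p = last b rest.
  have : last x (x :: p) = last b rest by rewrite Exp Es2 !last_cat /= last_cat.
  by [].
have [mb prest] : path e a (rcons m b) /\ path e b rest.
  by move: pas2; rewrite Es2 -cat_rcons cat_path last_rcons => /andP[].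
have sSs2 : {subset a :: s2 <= S}.
  by move=> z zs; apply: sS; rewrite Exp mem_cat zs orbT.
have bS : b \in S by apply: sSs2; rewrite Es2 inE mem_cat inE eqxx !orbT.
have aS : a \in S by apply: sSs2; rewrite inE eqxx.
have xS : x \in S by apply: sS; rewrite inE eqxx.
(* [Z] omits [a], which ends the stretch traversed from [x] or is [x] itself. *)
have [Z [Z0 sZ lZ fZ pZ]] : exists Z, [/\ Z != [::], sorted sq Z,
    lstP (pred1 b) Z, fstP (near b) Z & perm_eq Z (thick (rcons m b))].
  have sSm : {subset rcons m b <= S}.
    move=> z zm; apply: sSs2; rewrite Es2 -cat_rcons inE mem_cat zm.
    by rewrite orbT.
  case: (m) mb sSm => [|v0 m'] /=.
    move=> _ _; have [t1 t2] := thick1 bS; exists (rcons (clo b) b); split=> //.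
    - by rewrite -size_eq0 size_rcons.
    - by rewrite lstP_rcons /= eqxx.
    - by rewrite thick_cons thick_nil cats0.
  case/andP=> _ pm sSm.
  have v0S : v0 \in S by apply: sSm; rewrite inE eqxx.
  have [t1 t2] := thick1 v0S.
  have [||||Z] := @uturn (rcons m' b) v0 (rcons (clo v0) v0) pm sSm.
  - by rewrite -size_eq0 size_rcons.
  - by [].
  - by rewrite lstP_rcons /= eqxx.
  - by [].
  by rewrite last_rcons => ZP; exists Z.
have uab : uniq (rcons rest a) /\ a != b.
  move: uxp; rewrite Exp Es2 cat_uniq => /and3P[_ _] /=.
  rewrite mem_cat inE cat_uniq rcons_uniq /= !negb_or.
  by case/andP=> [/and3P[_ -> ->]] /and3P[_ _ /andP[_ ->]].
have [ur ab] := uab.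
have uE' : uniq (b :: r :: ends O') by rewrite -(perm_uniq pe).
have sub' z : z \in r :: ends O' -> z \in ends O.
  by rewrite (perm_mem pe) => zE; rewrite inE zE orbT.
have [|||||||||||Q [Q0 sQ fQ lQ pQ]] :=
  @sweep (size rest) rest b (rev s ++ Z) r O' a (leqnn _) prest.
- move=> z; rewrite inE mem_rcons inE => zz; apply: sSs2.
  rewrite Es2 inE mem_cat inE.
  by case/or3P: zz => ->; rewrite ?orbT.
- by rewrite cat_neq0 // rev_neq0.
- by apply: (glue bS); rewrite ?sorted_revE ?lstP_rev.
- by rewrite fstP_catl ?rev_neq0.
- by rewrite lstP_catr.
- by [].
- by case/andP: uE'.
- move=> z zE; have zO := sub' z zE.
  have zb : z != b by apply: contraTneq uE' => <-; rewrite [uniq _]/= zE.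
  rewrite mem_rcons inE; have := sE z zO.
  rewrite Exp mem_cat inE Es2 mem_cat inE (negPf zb) /=.
  case/or4P=> [z1|->//|zm|->]; rewrite ?orbT //.
    by have /allP/(_ z z1) := s1E; rewrite /= zO.
  by have /allP/(_ z zm) := mE; rewrite /= zO.
- by move: aE; rewrite /= (perm_mem pe) inE (negPf ab).
- by [].
- by move=> w wE; apply/cE/sub'.
have lQx : lstP (e x) Q.
  by apply: lstP_sub lQ => z /eqP->; rewrite -la e_sym.
have cx : s1 = [::] -> x = a by move=> s10; move: Exp; rewrite s10 => -[].
case: s1 Exp s1E cx => [|x' s1] Exp s1E cx.
  exists Q; have xa := cx erefl; split=> //; first by rewrite xa.
  apply/permP=> q; move/permP/(_ q): pQ; move/permP/(_ q): pZ.
  move/permP/(_ q): pi; rewrite Exp Es2 /= thick_cons cE //.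
  rewrite -cat_rcons thick_cat !count_cat count_rev /= xa.
  by count_lia.
case: Exp => xx Ep; subst x'.
have [||s1S f1] := @thickR_ok a s1 x.
- by move: xp; rewrite Ep -cat_rcons cat_path => /andP[].
- by move=> z zs; apply: sS; rewrite Ep -cat_cons mem_cat zs.
exists (rcons (thickR s1) a ++ Q ++ clo x); split.
- by rewrite cat_neq0 // -size_eq0 size_rcons.
- apply: (glue' aS) => //.
  + by apply: (glue xS) => //; apply: adj_near.
  + by rewrite lstP_rcons near_refl.
  + by rewrite fstP_catl.
- by rewrite fstP_catl // -size_eq0 size_rcons.
- rewrite catA lstP_cat; case: (clo x) (clo_lst x) => // _.
  by rewrite lstP_catr.
apply/permP=> q; move/permP/(_ q): pQ; move/permP/(_ q): pZ.
move/permP/(_ q): pi; rewrite Ep Es2 thick_cons thick_cat thick_cons (cE a aE).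
rewrite -cat_rcons thick_cat -!cats1 /= !count_cat count_rev /= thickRE !count_cat.
by count_lia.
Qed.

End Sweep.

(** * Merging trails that share an end *)

Definition share (a b : T * seq T * T) :=
  has (mem [:: a.1.1; a.2]) [:: b.1.1; b.2].

Lemma not_pairwise (A : eqType) (r : rel A) L : ~~ pairwise r L ->
  exists a b L', perm_eq L (a :: b :: L') /\ ~~ r a b.
Proof.
elim: L => //= a L IH; rewrite negb_and => /orP[/allPn[b bL rab]|/IH].
  exists a, b, (rem b L); split=> //.
  by rewrite perm_cons perm_to_rem.
case=> b [c [L' [pL rbc]]]; exists b, c, (a :: L'); split=> //.
by apply/permP=> q; move/permP/(_ q): pL => /= ->; count_lia.
Qed.

Lemma perm_ends L L' : perm_eq L L' -> perm_eq (ends L) (ends L').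
Proof. by move=> pL; apply: perm_flatten; apply: perm_map. Qed.

Lemma perm_inner L L' : perm_eq L L' -> perm_eq (inner L) (inner L').
Proof. by move=> pL; apply: perm_flatten; apply: perm_map. Qed.

(** Two trails with a common end [c] are joined with [c] as the middle of the step, which lowers
    their number. In the end no vertex belongs to two trails, so that closed and open trails do not
    compete for it. *)
Lemma merge_trails n : forall L, size L <= n -> all trail_ok L ->
  {subset ends L <= S} ->
  exists L', [/\ all trail_ok L', {subset ends L' <= ends L},
    perm_eq (inner L') (inner L) & pairwise (fun a b => ~~ share a b) L'].
Proof.
elim: n => [|n IH] L szL okL sS.
  by exists [::]; case: L szL {okL sS} => //= _; split.
have [pL|] := boolP (pairwise (fun a b => ~~ share a b) L).
  by exists L; split.
case/not_pairwise=> a [b [L1 [pL]]]; rewrite negbK => /hasP[c cb ca].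
have [okab] : trail_ok a /\ trail_ok b /\ all trail_ok L1.
  by move: okL; rewrite (perm_all _ pL) /= => /and3P[].
case=> okb okL1.
have toend (tr : T * seq T * T) : trail_ok tr -> c \in [:: tr.1.1; tr.2] ->
    exists l s, [/\ trail_ok (l, s, c), perm_eq [:: l; c] [:: tr.1.1; tr.2]
      & perm_eq s tr.1.2].
  case: tr => [[l s] r] /= tok; rewrite !inE => /orP[]/eqP->.
    exists r, (rev s); split; first exact: trail_rev.
      by rewrite (perm_catC [:: r] [:: l]).
    by rewrite perm_rev.
  by exists l, s; split.
have [l [s [tok1 p1 q1]]] := toend a okab ca.
have [l' [s' [tok2 p2 q2]]] := toend b okb cb.
have cS : c \in S.
  apply: sS; rewrite (perm_mem (perm_ends pL)) ends_cons.
  move: ca; rewrite /= !inE => /orP[]/eqP->; rewrite eqxx ?orbT //.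
pose tr := (l, s ++ rev s', l').
have tok : trail_ok tr.
  have /and4P[/= a1 a2 a3 a4] := tok1; have /and4P[/= b1 b2 b3 b4] := tok2.
  apply/and4P; split=> /=.
  - by rewrite cat_neq0.
  - by apply: (@glue c) => //; rewrite ?sorted_revE //; apply: adj_near.
  - by rewrite fstP_catl.
  - by rewrite lstP_catr ?rev_neq0 // lstP_rev.
have pL2 := perm_ends pL.
have sub : {subset ends (tr :: L1) <= ends L}.
  move=> z; rewrite (perm_mem pL2) !ends_cons !inE /=.
  have -> : (z == a.1.1) || [|| z == a.2, z == b.1.1, z == b.2 | z \in ends L1]
     = (z \in [:: l; c]) || (z \in [:: l'; c]) || (z \in ends L1).
    by rewrite (perm_mem p1) (perm_mem p2) !inE !orbA.
  by rewrite !inE; case/or3P=> ->; rewrite ?orbT.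
have [|||L' [L1' L2' L3' L4']] := IH (tr :: L1).
- by move: szL; rewrite (perm_size pL).
- by rewrite /= tok.
- by move=> z /sub/sS.
exists L'; split=> //; first by move=> z /L2'/sub.
apply: perm_trans L3' _; rewrite perm_sym; apply: perm_trans (perm_inner pL) _.
apply/permP=> q; move/permP/(_ q): q1; move/permP/(_ q): q2.
by rewrite !inner_cons /= !count_cat count_rev; count_lia.
Qed.

Fixpoint clo_of (L : seq (T * seq T * T)) v : seq T :=
  if L is tr :: L' then
    if (tr.1.1 == v) && (tr.2 == v) then tr.1.2 else clo_of L' v
  else [::].

Lemma clo_of_ok L v : all trail_ok L ->
  [/\ sorted sq (clo_of L v), fstP (e v) (clo_of L v) & lstP (e v) (clo_of L v)].
Proof.
elim: L => //= -[[l s] r] L IH /andP[/and4P[/= a1 a2 a3 a4] okL].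
by case: ifP => [/andP[/eqP<- /eqP rl]|_]; [rewrite -{2}rl | apply: IH].
Qed.

Definition isopen (tr : T * seq T * T) := tr.1.1 != tr.2.

Lemma clo_notin L w : w \notin ends L -> clo_of L w = [::].
Proof.
elim: L => // tr L IH; rewrite ends_cons !inE !negb_or => /and3P[a1 a2 a3].
by rewrite /= eq_sym (negPf a1) /=; apply: IH.
Qed.

Lemma share_notin tr L w : all (fun b => ~~ share tr b) L ->
  w \in [:: tr.1.1; tr.2] -> w \notin ends L.
Proof.
move=> aL wtr; elim: L aL => // b L IH /= /andP[sb /IH wL].
rewrite ends_cons !inE !negb_or wL andbT; apply: contraNT sb.
rewrite negb_and !negbK => wb; apply/hasP; exists w; last by [].
by rewrite !inE.
Qed.

Lemma ends_filter P L : {subset ends (filter P L) <= ends L}.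
Proof.
elim: L => // tr L IH z /=; rewrite ends_cons; case: ifP => _.
  rewrite ends_cons !inE => /or3P[->|->|/IH->]; rewrite ?orbT //.
by move/IH; rewrite !inE => ->; rewrite !orbT.
Qed.

Lemma clo_open L w : pairwise (fun a b => ~~ share a b) L ->
  w \in ends (filter isopen L) -> clo_of L w = [::].
Proof.
elim: L => // tr L IH /= /andP[aL pL].
case: ifP => [trO|trO].
  rewrite ends_cons inE inE orbA => /orP[wtr|wL]; last first.
    case: ifP => [/andP[/eqP E _]|_]; last exact: IH.
    have := @share_notin _ _ w aL; rewrite !inE E eqxx => /(_ isT).
    by rewrite (ends_filter wL).
  case: ifP => [/andP[/eqP E1 /eqP E2]|_]; first by rewrite /isopen E1 E2 eqxx in trO.
  by apply: clo_notin; apply: (share_notin aL); rewrite !inE.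
move=> wL; case: ifP => [/andP[/eqP E _]|_]; last exact: IH.
have := @share_notin _ _ w aL; rewrite !inE E eqxx => /(_ isT).
by rewrite (ends_filter wL).
Qed.

Lemma uniq_open L : pairwise (fun a b => ~~ share a b) L ->
  uniq (ends (filter isopen L)).
Proof.
elim: L => [|tr L IH] /=; first by rewrite ends_nil.
case/andP=> aL /IH u; case: ifP => // trO; rewrite ends_cons /= inE u andbT.
have nin w : w \in [:: tr.1.1; tr.2] -> w \notin ends (filter isopen L).
  by move=> wtr; apply: contra (share_notin aL wtr); apply: ends_filter.
by rewrite (negPf trO) !nin ?inE ?eqxx ?orbT.
Qed.

Lemma thick_upd clo s v0 C : uniq C -> v0 \in C -> clo v0 = [::] ->
  forall q, count q (thick (fun v => if v0 == v then s else clo v) C)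
    = count q s + count q (thick clo C).
Proof.
move=> uC v0C c0 q; elim: C uC v0C => // v C IH /= /andP[vC uC].
rewrite !thick_cons !count_cat inE => /orP[/eqP E|v0C].
  have cv : clo v = [::] by rewrite -E.
  rewrite E eqxx -!cats1 !count_cat cv /=.
  have -> : count q (thick (fun v1 => if v == v1 then s else clo v1) C)
     = count q (thick clo C).
    congr count; congr flatten; apply/eq_in_map => u uC'.
    by case: eqP => // vu; rewrite vu uC' in vC.
  by count_lia.
rewrite IH //; case: eqP => [E|_]; first by rewrite -E v0C in vC.
by count_lia.
Qed.

Lemma thick_ext clo clo' C : clo =1 clo' -> thick clo C = thick clo' C.
Proof. by move=> E; congr flatten; apply: eq_map => v; rewrite E. Qed.

Lemma thick_open L C : uniq C -> {subset ends L <= C} ->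
  pairwise (fun a b => ~~ share a b) L ->
  forall q, count q (thick (clo_of L) C) + count q (inner (filter isopen L))
    = count q C + count q (inner L).
Proof.
move=> uC sC pL q; elim: L sC pL => [|tr L IH] sC /=.
  move=> _; rewrite inner_nil; congr (_ + _).
  elim: (C) => // v C' IH; rewrite thick_cons count_cat IH /=.
  by count_lia.
case/andP=> aL pL.
have {}IH := IH _ pL.
have sL : {subset ends L <= C}.
  by move=> z zL; apply: sC; rewrite ends_cons !inE zL !orbT.
have {}IH := IH sL; rewrite inner_cons count_cat.
case: ifP => trO.
  rewrite inner_cons count_cat.
  rewrite (@thick_ext _ (clo_of L)) => [|v]; first by move: IH; count_lia.
  by case: ifP => // /andP[/eqP E1 /eqP E2]; rewrite /isopen E1 E2 eqxx in trO.
have E : tr.1.1 = tr.2 by apply/eqP; move: trO; rewrite /isopen; case: eqP.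
rewrite (@thick_ext _ (fun v => if tr.2 == v then tr.1.2 else clo_of L v));
  last by move=> v; rewrite E andbb.
rewrite thick_upd //; first by move: IH; count_lia.
- by apply: sC; rewrite ends_cons !inE eqxx orbT.
- by apply: clo_notin; apply: (share_notin aL); rewrite !inE eqxx orbT.
Qed.

Lemma combine x p y L : path e x p -> e (last x p) x -> uniq (x :: p) ->
  {subset x :: p <= S} -> all trail_ok L -> {subset ends L <= x :: p} ->
  y \in p -> y \notin ends L ->
  exists t, [/\ t != [::], sorted sq t, fstP (e x) t, lstP (e x) t
    & perm_eq (x :: t) ((x :: p) ++ inner L)].
Proof.
move=> xp lp uxp sS okL sL yp yL.
have [|L' [okL' sL' iL' pL']] := @merge_trails (size L) L (leqnn _) okL.
  by move=> z /sL/sS.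
have sC : {subset ends L' <= x :: p} by move=> z /sL'/sL.
have c1 v : sorted sq (clo_of L' v) by have [] := clo_of_ok v okL'.
have c2 v : fstP (e v) (clo_of L' v) by have [] := clo_of_ok v okL'.
have c3 v : lstP (e v) (clo_of L' v) by have [] := clo_of_ok v okL'.
have cnt := thick_open uxp sC pL'.
(* Without open trails there is no terminal at which to turn, and [y] takes over this task. *)
have [O0|O0] := eqVneq (filter isopen L') [::].
  have cy : clo_of L' y = [::].
    by apply: clo_notin; apply: contra yL; apply: sL'.
  have [t [t1 t2 t3 t4 t5]] := combine_closed c1 c2 c3 xp lp sS yp cy.
  exists t; split=> //; apply/permP=> q; move/permP/(_ q): t5 => ->.
  move: (cnt q); rewrite O0 inner_nil addn0 => ->; rewrite count_cat; congr (_ + _).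
  by move/permP/(_ q): iL'.
have [||||t [t1 t2 t3 t4 t5]] :=
  combine_open c1 c2 c3 xp lp uxp sS O0.
- by apply/allP=> tr; rewrite mem_filter => /andP[_ /(allP okL')].
- exact: uniq_open.
- by move=> z /ends_filter/sC.
- by move=> w; apply: clo_open.
exists t; split=> //; apply/permP=> q; move/permP/(_ q): t5 => ->.
rewrite [LHS]count_cat cnt [RHS]count_cat; congr (_ + _).
by move/permP/(_ q): iL'.
Qed.

End Square.

(** * Fleischner's theorem *)

Section Fleischner.
Variable T : finType.
Implicit Types (e : rel T) (S D : {set T}).

Definition erel e S : rel T := [rel a b in S | e a b].

Definition conn e S := {in S &, forall a b, connect (erel e S) a b}.

(** 2-connectedness of an induced subgraph, with relation and vertex set as parameters, so that
    passing to a contraction does not change the type. *)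
Definition biconn e S :=
  [/\ 2 < #|S|, conn e S & forall v, v \in S -> conn e (S :\ v)].

Lemma connect_ind (r : rel T) (P : pred T) a b :
  (forall u v, P u -> r u v -> P v) -> connect r a b -> P a -> P b.
Proof.
move=> Pr /connectP[p rp ->]; elim: p a rp => //= u p IH a /andP[au up] Pa.
by apply: IH up _; apply: Pr au.
Qed.

Lemma connect_exit (r : rel T) (P : pred T) a b :
  connect r a b -> P a -> ~~ P b -> exists u v, [/\ P u, ~~ P v & r u v].
Proof.
move=> /connectP[p rp ->]; elim: p a rp => [|u p IH] a /=; first by move=> _ ->.
case/andP=> au up Pa; case Pu: (P u); first exact: IH.
by exists a, u; rewrite Pu.
Qed.

Lemma erel_sym e S : symmetric e -> symmetric (erel e S).
Proof. by move=> es a b; rewrite /erel /= es (andbC (a \in S)). Qed.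

Lemma conn_path e S a b : a \in S -> connect (erel e S) a b ->
  exists q, [/\ path (erel e S) a q, path e a q, uniq (a :: q), last a q = b
    & {subset a :: q <= S}].
Proof.
move=> aS /connectP[p rp ->]; case: (shortenP rp) => q rq uq _.
exists q; split=> //; first by apply: sub_path rq => u v /= /andP[].
elim: q a aS rq {rp uq p} => [|u q IH] a aS /= => [_|/andP[/andP[/andP[_ uS] _] uq]].
  by move=> z; rewrite inE => /eqP->.
by move=> z; rewrite inE => /orP[/eqP->|/(IH u uS uq)].
Qed.

Definition component e S d := [set z | connect (erel e S) d z].

Lemma componentS e S d : d \in S -> component e S d \subset S.
Proof.
move=> dS; apply/subsetP=> z; rewrite inE => dz.
by apply: (connect_ind (P := mem S)) dz dS => u v _ /andP[/andP[]].
Qed.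

Lemma component_step e S d a b : d \in S -> a \in component e S d -> b \in S -> e a b ->
  b \in component e S d.
Proof.
move=> dS aD bS ab; move: (aD); rewrite !inE => da.
apply: connect_trans da (connect1 _).
by rewrite /erel /= (subsetP (componentS e dS) a aD) bS.
Qed.

Lemma component_conn e (R : {set T}) d : symmetric e -> d \in R ->
  conn e (component e R d).
Proof.
move=> es dR; set D := component e R d.
have cd z : z \in D -> connect (erel e D) d z.
  rewrite inE => dz.
  suff /andP[] : (z \in D) && connect (erel e D) d z by [].
  apply: (connect_ind (P := [pred z | (z \in D) && connect (erel e D) d z])) dz _.
    move=> u v /= /andP[uD cu] /andP[/andP[_ vR] uv].
    have vD : v \in D by apply: component_step uv.
    by rewrite vD; apply: connect_trans cu (connect1 _); rewrite /erel /= uD vD.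
  by rewrite /= [d \in D]inE !connect0.
move=> a b aD bD; apply: connect_trans (cd b bD).
by rewrite (sym_connect_sym (erel_sym _ es)) cd.
Qed.

Definition is_cycle e S x p :=
  [/\ cycle e (x :: p), uniq (x :: p), 1 < size p & {subset x :: p <= S}].

Lemma neighbours e S x : conn e S -> x \in S -> 1 < #|S| ->
  exists2 a, a \in S :\ x & e x a.
Proof.
move=> cS xS; rewrite (cardsD1 x) xS => /card_gt0P[b]; rewrite !inE => /andP[bx bS].
have [u [v [/eqP-> vx /= /andP[/andP[_ vS] xv]]]] :=
  connect_exit (P := pred1 x) (cS x b xS bS) (eqxx x) bx.
by exists v => //; rewrite !inE vx.
Qed.

(** Two neighbours of [x] are joined by a path avoiding [x]; the second neighbour exists because [x]
    is not isolated once the first is deleted. *)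
Lemma cycle_through e S x : symmetric e -> biconn e S -> x \in S ->
  exists p, is_cycle e S x p.
Proof.
move=> es [S3 cS cSv] xS.
have [|a aS xa] := neighbours cS xS; first exact: ltnW.
have [ax aS'] : a != x /\ a \in S by move: aS; rewrite !inE => /andP.
have [||b] := @neighbours e (S :\ a) x (cSv a aS').
- by rewrite !inE eq_sym ax.
- by move: S3; rewrite (cardsD1 a) aS'.
rewrite !inE => /and3P[bx ba bS] xb.
have [|q [_ aq uq lq qS]] := conn_path aS (cSv x xS a b aS _).
  by rewrite !inE bx.
exists (a :: q); split.
- by rewrite /= xa rcons_path aq lq es.
- by rewrite cons_uniq uq andbT; apply/negP => /qS; rewrite !inE eqxx.
- by case: q lq {aq uq qS} => //= E; rewrite E eqxx in ba.
- by move=> z; rewrite inE => /orP[/eqP->//|/qS]; rewrite inE => /andP[].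
Qed.

Lemma cycle_cut e s1 (u : T) s2 w s3 : cycle e (s1 ++ u :: s2 ++ w :: s3) ->
  path e w (s3 ++ rcons s1 u).
Proof.
rewrite -(rot_cycle (size s1)) rot_size_cat /= rcons_path.
rewrite -catA cat_path /= => /andP[/andP[_ /andP[_]]].
rewrite !last_cat /= last_cat => ws3 l; rewrite -rcons_cat rcons_path ws3.
by rewrite last_cat.
Qed.

Lemma cycle_paste e s1 (u : T) q w s3 : path e w (s3 ++ rcons s1 u) ->
  path e u (rcons q w) -> cycle e (s1 ++ u :: q ++ w :: s3).
Proof.
move=> p1 p2; rewrite -(rot_cycle (size s1)) rot_size_cat /=.
rewrite -cat_rcons -catA rcons_cat cat_path p2 last_rcons.
by rewrite rcons_cat.
Qed.

(* Reroute the cycle through the component of [d], between two consecutive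
   attachment vertices of this component: what is left of it is smaller. *)
Lemma good_cycle e S x n : symmetric e -> biconn e S -> x \in S ->
  forall p d, is_cycle e S x p -> d \in S :\: [set z in x :: p] ->
  #|component e (S :\: [set z in x :: p]) d| <= n ->
  exists p' y, [/\ is_cycle e S x p', y \in p'
    & forall w, w \in S -> e y w -> w \in x :: p'].
Proof.
move=> es [S3 cS cSv] xS; elim: n => [|n IH] p d [cp up sp pS] dR.
  rewrite leqn0 cards_eq0 => /eqP E; have : d \in component e (S :\: [set z in x :: p]) d.
    by rewrite inE.
  by rewrite E inE.
set R := S :\: _ in dR *; set D := component e R d => szD.
have DR : {subset D <= R} by apply/subsetP/componentS.
have RS z : z \in R -> z \in S by rewrite inE => /andP[].
have RC z : z \in R -> z \notin x :: p by rewrite inE => /andP[]; rewrite inE.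
have dD : d \in D by rewrite inE.
have attC a b : a \in D -> b \in S -> e a b -> b \notin D -> b \in x :: p.
  move=> aD bS ab; apply: contraNT => bC; apply: component_step ab => //.
  by rewrite inE bS andbT inE.
pose A := [pred c | (c \in x :: p) && [exists z in D, e z c]].
have attA a b : a \in D -> b \in S -> e a b -> b \notin D -> A b.
  by move=> aD bS ab bD; rewrite /A /= (attC a b) //; apply/exists_inP; exists a.
have CD c : c \in x :: p -> c \notin D by apply: contraL => /DR/RC.
have RC' z : z \in D -> (z \in x :: p) = false by move=> /DR/RC/negPf.
have xC : x \in x :: p by rewrite inE eqxx.
(* By 2-connectedness [D] has two attachment vertices: one where a path leaves [D], and one where a
   path avoiding the first does. *)
have [u1 [c1 [u1D c1D /= /andP[/andP[_ c1S] uc1]]]] :=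
  connect_exit (P := mem D) (cS d x (RS _ dR) xS) dD (CD x xC).
have Ac1 := attA _ _ u1D c1S uc1 c1D.
have [c' [c'C c'c1]] : exists c', c' \in x :: p /\ c' != c1.
  have [xc|xc] := eqVneq x c1; last by exists x.
  case: (p) sp up => // z p' _ /= /andP[xn _]; exists z.
  rewrite !inE eqxx orbT -xc; split=> //.
  by apply: contraNneq xn => ->; rewrite inE eqxx.
have dc1 : d \in S :\ c1.
  rewrite !inE (RS _ dR) andbT; apply: contraTneq Ac1 => <-.
  by rewrite /A /= (negPf (RC _ dR)).
have c'S : c' \in S :\ c1 by rewrite !inE c'c1 pS.
have [u2 [c2 [u2D c2D /= /andP[/andP[_ c2S] uc2]]]] :=
  connect_exit (P := mem D) (cSv c1 c1S d c' dc1 c'S) dD (CD c' c'C).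
have [c21 c2S'] : c2 != c1 /\ c2 \in S by move: c2S; rewrite !inE => /andP.
have Ac2 := attA _ _ u2D c2S' uc2 c2D.
(* Since [u] and [w] are the first two attachment vertices after the start of the list, the arc [s2]
   to be replaced does not contain [x]. *)
have /first_terminal[s1 [u [r [E1 Au s1A]]]] : has A (x :: p).
  by apply/hasP; exists c1 => //; case/andP: Ac1.
have : has A r.
  apply: contraNT c21 => /hasPn rA.
  suff uc c : A c -> c = u by rewrite (uc c1) // (uc c2).
  move=> Ac; have : c \in x :: p by case/andP: Ac.
  rewrite E1 mem_cat inE => /or3P[cs|/eqP//|cr]; last by case/negP: (rA c cr).
  by have /allP/(_ c cs)/negP := s1A; case.
case/first_terminal=> s2 [w [s3 [E2 Aw s2A]]]; subst r.
have {Au}[uC /exists_inP[du duD duu]] := andP Au.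
have {Aw}[wC /exists_inP[dw dwD dww]] := andP Aw.
have cdu : connect (erel e R) du dw.
  have := duD; have := dwD; rewrite !inE => cw cu; apply: connect_trans _ cw.
  by rewrite (sym_connect_sym (erel_sym _ es)).
have [q [rq eq uq lq qR]] := conn_path (DR _ duD) cdu.
have qD z : z \in du :: q -> z \in D.
  move=> zq; have := duD; rewrite !inE => cu; apply: connect_trans cu _.
  exact: path_connect rq _ zq.
pose N := s1 ++ u :: (du :: q) ++ w :: s3.
have [p' EN] : exists p', N = x :: p'.
  by rewrite /N; case: (s1) E1 => [|x' s] [<- _]; eexists.
have uN : uniq N.
  have sub : subseq (s1 ++ u :: w :: s3) (x :: p).
    rewrite E1; apply: cat_subseq => //; rewrite -[u :: w :: s3]cat1s.
    by rewrite -[u :: s2 ++ _]cat1s; apply: cat_subseq => //; apply: suffix_subseq.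
  have pN : perm_eq N ((du :: q) ++ (s1 ++ u :: w :: s3)).
    by apply/permP=> P; rewrite /N; do 4 rewrite ?count_cat /=; count_lia.
  rewrite (perm_uniq pN) cat_uniq uq (subseq_uniq sub up) andbT /=.
  by apply/hasPn => z /(mem_subseq sub) zC; apply/negP => /qD/RC'; rewrite zC.
have cN : cycle e N.
  apply: cycle_paste; first by apply: (@cycle_cut e s1 u s2); rewrite -E1.
  by rewrite /= es duu rcons_path eq lq.
have NS : {subset N <= S}.
  move=> z zN; have [/qR/RS//|] := boolP (z \in du :: q).
  move=> zq; apply: pS; move: zq zN; rewrite E1 /N !(mem_cat, inE).
  by case: (z \in s1); case: (z == u); case: (_ || _); rewrite //= => _ ->; rewrite orbT.
have cyN : is_cycle e S x p'.
  split; rewrite -?EN //.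
  have := congr1 size EN; rewrite /N; do 3 rewrite ?size_cat /=; clear; lia.
have inN z : A z -> z \in N.
  move=> Az; have : z \in x :: p by case/andP: Az.
  rewrite E1 /N !(mem_cat, inE) => /or4P[->|->|zs|zs]; rewrite ?orbT //.
    by have /allP/(_ z zs)/negP := s2A; case.
  by case/orP: zs => ->; rewrite ?orbT.
(* If the new cycle absorbs [D], then [du] has all its neighbours on it: they lie in [D] or are
   attachment vertices. *)
have [DN|/subsetPn[d' d'D d'N]] := boolP (D \subset [set z in N]).
  exists p', du; split=> //.
    have : du \in x :: p'.
      by have := subsetP DN du duD; rewrite inE EN.
    rewrite inE => /orP[/eqP dux|//].
    by have := CD x xC; rewrite -dux duD.
  move=> z zS dz; rewrite -EN.
  have [zD|zD] := boolP (z \in D); first by have := subsetP DN z zD; rewrite inE.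
  exact/inN/(attA du).
apply: (IH p' d' cyN).
  by rewrite inE -EN d'N RS ?DR.
rewrite -ltnS; apply: leq_trans szD; apply: proper_card.
have RN z : z \in S :\: [set z in x :: p'] -> z \notin N.
  by rewrite !inE EN => /andP[].
have d'R : d' \in S :\: [set z in x :: p'] by rewrite inE -EN d'N RS ?DR.
apply/properP; split; last first.
  have duN : du \in N by rewrite /N !(mem_cat, inE) eqxx !orbT.
  by exists du => //; apply/negP => /(subsetP (componentS e d'R))/RN; rewrite duN.
(* A path that avoids the new cycle cannot leave [D], since it would do so at an attachment
   vertex. *)
apply/subsetP=> z; rewrite [z \in component _ _ _]inE => d'z.
apply: (connect_ind (P := mem D)) d'z d'D => a b aD /andP[/andP[_ bR] ab].
apply: contraR (RN _ bR) => bD; apply: inN; apply: (attA a) => //.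
by move: bR; rewrite inE => /andP[].
Qed.

(* The path [t] comes from the graph where all the vertices outside a component
   are contracted: it is cut where it passes through the contracted vertex. *)
Lemma split_trails e S (P att : pred T) t : symmetric e ->
  (forall a, att a -> exists2 c, P c & e c a) ->
  t != [::] -> sorted [rel a b | sq e S a b || (att a && att b)] t ->
  fstP att t -> lstP att t ->
  exists L, [/\ all (trail_ok e S) L, all P (ends L) & inner L = t].
Proof.
move=> es attP; case: t => // a t _ /= tP fa; rewrite lstP_last => la.
have [s [r [L [[ps pr er] okL PL tE]]]] : exists s r L,
    [/\ [/\ path (sq e S) a s, P r & e r (last a s)], all (trail_ok e S) L,
      all P (ends L) & s ++ inner L = t].
  elim: t a tP la {fa} => [|b t IH] a /=.
    by move=> _ /attP[r Pr er]; exists [::], r, [::]; rewrite ends_nil inner_nil.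
  case/andP=> ab tP lb; have [s [r [L [[ps Pr er] okL PL tE]]]] := IH b tP lb.
  have [sab|sab] := boolP (sq e S a b).
    by exists (b :: s), r, L; split; rewrite //= ?sab // tE.
  move: ab; rewrite (negPf sab) /= => /andP[/attP[c Pc ca] /attP[l Pl lb']].
  exists [::], c, ((l, b :: s, r) :: L); split=> //.
  - by rewrite /= okL andbT; apply/and4P; split; rewrite //= lstP_last.
  - by rewrite ends_cons /= Pl Pr PL.
  - by rewrite inner_cons /= tE.
have [l Pl la'] := attP a fa.
exists ((l, a :: s, r) :: L); split.
- by rewrite /= okL andbT; apply/and4P; split; rewrite //= lstP_last.
- by rewrite ends_cons /= Pl pr PL.
- by rewrite inner_cons /= tE.
Qed.

Theorem fleischner n : forall e S x, symmetric e -> #|S| <= n -> biconn e S ->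
  x \in S -> exists t, [/\ t != [::], sorted (sq e S) t, fstP (e x) t,
    lstP (e x) t & perm_eq (x :: t) (enum S)].
Proof.
elim: n => [|n IH] e S x es szS bS xS.
  by move: bS => [S3]; rewrite leqNgt (leq_trans _ S3) // in szS.
have [S3 cS cSv] := bS.
have [p0 cyc0] := cycle_through es bS xS.
have [p [y [[cp up sp pS] yp Ny]]] : exists p' y, [/\ is_cycle e S x p', y \in p'
    & forall w, w \in S -> e y w -> w \in x :: p'].
  have [R0|/set0Pn[d dR]] := eqVneq (S :\: [set z in x :: p0]) set0; last first.
    have := @good_cycle e S x _ es bS xS p0 d cyc0 dR (leqnn _).
    by [].
  case: p0 cyc0 R0 => [|y p0] cyc0 R0; first by case: cyc0.
  exists (y :: p0), y; split; rewrite ?inE ?eqxx // => w wS _.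
  have := in_set0 w; rewrite -R0 !inE wS andbT => /negbFE.
  exact.
set R := S :\: [set z in x :: p].
have RS z : z \in R -> z \in S by rewrite inE => /andP[].
have RC z : z \in R -> z \notin x :: p by rewrite inE => /andP[]; rewrite inE.
have SR z : z \in S -> z \notin x :: p -> z \in R.
  by move=> zS zC; rewrite !inE zS andbT -in_cons.
(* No trail ends at [y], because all the neighbours of [y] are on the cycle. *)
pose P := [pred c | (c \in x :: p) && (c != y)].
pose att D := [pred a | (a \in D) && [exists c in [set z in x :: p], e c a]].
have attP (D : {set T}) a : {subset D <= R} -> att D a -> exists2 c, P c & e c a.
  move=> DR /andP[aD /exists_inP[c]]; rewrite inE => cC ca; exists c => //.
  rewrite /P /= cC; apply: contraTneq ca => ->; apply/negP => /(Ny _ (RS _ (DR _ aD))).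
  by rewrite (negPf (RC _ (DR _ aD))).
have step d : d \in R -> exists L, [/\ all (trail_ok e S) L, all P (ends L)
    & perm_eq (inner L) (enum (component e R d))].
  move=> dR; set D := component e R d.
  have DR : {subset D <= R} by apply/subsetP/componentS.
  have dD : d \in D by rewrite inE.
  suff [t [t0 tP ft lt pt]] : exists t, [/\ t != [::],
      sorted [rel a b | sq e S a b || (att D a && att D b)] t,
      fstP (att D) t, lstP (att D) t & perm_eq t (enum D)].
    have [L [L1 L2 L3]] := split_trails es (fun a => @attP D a DR) t0 tP ft lt.
    by exists L; rewrite L3.
  have stepD a b : a \in D -> b \in S -> e a b -> b \notin D -> att D a.
    move=> aD bS' ab bD; rewrite /att /= aD; apply/exists_inP; exists b; last by rewrite es.
    by rewrite inE; apply: contraNT bD => bC; apply: component_step ab => //; apply: SR.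
  have xD : x \notin D by apply/negP => /DR/RC; rewrite inE eqxx.
  have connD : conn e D by apply: component_conn.
  clearbody D.
  (* On a walk from [a] to [x] inside [X], the last vertex before [D] is left for the first time is
     attached to the cycle. *)
  have exitD (X : {set T}) a : a \in D -> a \in X -> {subset X <= S} ->
      connect (erel e X) a x ->
      exists b, [/\ att D b, b \in D :&: X & connect (erel e (D :&: X)) a b].
    move=> aD aX XS /connectP[q rq lq]; elim: q a aD aX rq lq => [|u q IHq] a aD aX /=.
      by move=> _ E; rewrite E aD in xD.
    case/andP=> /andP[/andP[_ uX] au] uq lq; have [uD|uD] := boolP (u \in D).
      have [b [b1 b2 b3]] := IHq u uD uX uq lq; exists b; split=> //.
      by apply: connect_trans (connect1 _) b3; rewrite /erel /= !inE aD aX uD uX.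
    exists a; split; [|by rewrite inE aD|exact: connect0].
    exact: stepD aD (XS _ uX) au uD.
  (* With a single vertex in [D] the contraction would have only two vertices, too few for
     [biconn]. *)
  have [D1|D1] := eqVneq #|D| 1.
    have Dd : D = [set d].
      by have/eqP/cards1P[d' E] := D1; move: dD; rewrite E inE => /eqP->.
    have [b [ab bD _]] := exitD S d dD (RS d dR) (fun z => id) (cS d x (RS d dR) xS).
    have E : b = d by move: bD; rewrite Dd !inE => /andP[/eqP].
    by rewrite E in ab; exists [:: d]; split; rewrite // Dd enum_set1.
  (* As [x] is not in [D], it can stand for everything outside [D]: the contracted graph lives on
     [x |: D]. *)
  pose e' : rel T := [rel a b | [|| [&& a \in D, b \in D & e a b],
    (a == x) && att D b | (b == x) && att D a]].
  have es' : symmetric e'.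
    move=> a b; rewrite /e' /= es andbCA; congr (_ || _); exact: orbC.
  have lift (Y Z : {set T}) a b : {subset Y <= D} -> {subset Y <= Z} ->
      connect (erel e Y) a b -> connect (erel e' Z) a b.
    move=> YD YZ; apply: connect_sub => u v /andP[/andP[uY vY] uv].
    by apply: connect1; rewrite /erel /e' /= !YZ // !YD // uv.
  have toX (X : {set T}) a : {subset X <= S} -> x \in X -> conn e X ->
      a \in (x |: D) :&: X -> connect (erel e' ((x |: D) :&: X)) a x.
    move=> XS xX cX; rewrite !inE => /andP[/orP[/eqP->|aD] aX]; first exact: connect0.
    have [b [ab bX cab]] := exitD X a aD aX XS (cX a x aX xX).
    apply: connect_trans (lift _ _ a b _ _ cab) (connect1 _).
    - by move=> z; rewrite inE => /andP[].
    - by move=> z; rewrite !inE => /andP[-> ->]; rewrite orbT.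
    move: bX; rewrite inE => /andP[bD bX].
    have ebx : e' b x by rewrite /e' /=; apply/or3P; apply: Or33; rewrite eqxx.
    by rewrite /erel /= ebx !inE bD bX xX eqxx !orbT.
  have connX (X : {set T}) : {subset X <= S} -> x \in X -> conn e X ->
      conn e' ((x |: D) :&: X).
    move=> XS xX cX a b aX bX; apply: connect_trans (toX X a XS xX cX aX) _.
    by rewrite (sym_connect_sym (erel_sym _ es')) toX.
  have DS : {subset x |: D <= S}.
    by move=> z; rewrite !inE => /orP[/eqP->//|/DR/RS].
  have bic : biconn e' (x |: D).
    split.
    - rewrite cardsU1 xD /= add1n ltnS.
      by have : 0 < #|D|; [apply/card_gt0P; exists d | move: D1; clear; lia].
    - by have := connX S (fun z => id) xS cS; rewrite (setIidPl _) //; apply/subsetP.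
    move=> v; rewrite !inE => /orP[/eqP->|vD].
      by rewrite setU1K // => a b aD bD; apply: (lift D); rewrite ?connD.
    have vx : v != x by apply: contraNneq xD => <-.
    have := connX (S :\ v); rewrite setIDA (setIidPl _) //; last exact/subsetP.
    apply; first by move=> z; rewrite inE => /andP[].
      by rewrite !inE eq_sym vx.
    by apply: cSv; apply/RS/DR.
  (* [D] misses both [x] and [y], so the set is still smaller than [S] after [x] is added. *)
  have szD : #|x |: D| <= n.
    rewrite cardsU1 xD add1n.
    have : D \subset S :\ x :\ y.
      apply/subsetP=> z zD; rewrite !inE (RS _ (DR _ zD)) andbT.
      have /norP[zx zp] : ~~ ((z == x) || (z \in p)) by rewrite -in_cons RC ?DR.
      by rewrite zx andbT; apply: contraNneq zp => ->.
    have yx : y != x by apply: contraTneq up => <-; rewrite /= yp.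
    move/subset_leq_card; move: szS; rewrite (cardsD1 x) xS (cardsD1 y).
    by rewrite !inE yx pS ?inE ?yp ?orbT //; clear; lia.
  have [t [t0 st ft lt pt]] := IH e' (x |: D) x es' szD bic (setU11 _ _).
  have e'x a : e' x a -> att D a.
    by rewrite /e' /= (negPf xD) eqxx /= andbF orbF.
  have {}pt : perm_eq t (enum D).
    rewrite -(perm_cons x); apply: perm_trans pt _; apply: uniq_perm.
    - exact: enum_uniq.
    - by rewrite /= mem_enum xD enum_uniq.
    - by move=> z; rewrite inE !mem_enum !inE.
  exists t; split=> //.
  - apply: (@sub_in_sorted _ (mem D) (sq e' (x |: D))) st; last first.
      by apply/allP=> z; rewrite (perm_mem pt) mem_enum.
    move=> a b aD bD /orP[|/exists_inP[w]].
      rewrite /e' /= => /or3P[/and3P[_ _ ab]|/andP[/eqP ax]|/andP[/eqP bx]].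
      + by rewrite sq_adj.
      + by rewrite -ax aD in xD.
      + by rewrite -bx bD in xD.
    rewrite !inE => /orP[/eqP->|wD] /andP[aw wb].
      by apply/orP; right; apply/andP; split; apply: e'x; rewrite // es'.
    have wx : w != x by apply: contraNneq xD => <-.
    have ax : a != x by apply: contraNneq xD => <-.
    have bx : b != x by apply: contraNneq xD => <-.
    move: aw wb; rewrite /e' /= (negPf wx) (negPf ax) (negPf bx) /= !orbF.
    case/and3P=> _ _ aw /and3P[_ _ wb].
    by rewrite (@sq_via _ e S w) // RS ?DR.
  - exact: fstP_sub ft.
  - exact: lstP_sub lt.
have trails m : forall R' : {set T}, #|R'| <= m -> {subset R' <= R} ->
    (forall a b, a \in R' -> b \in R -> e a b -> b \in R') ->
    exists L, [/\ all (trail_ok e S) L, all P (ends L)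
    & perm_eq (inner L) (enum R')].
  elim: m => [|m IHm] R' szR R'R cl.
    exists [::]; rewrite ends_nil inner_nil; split=> //.
    move: szR; rewrite leqn0 cards_eq0 => /eqP->.
    by rewrite enum_set0.
  have [->|/set0Pn[d dR']] := eqVneq R' set0.
    by exists [::]; rewrite ends_nil inner_nil enum_set0.
  have [L1 [a1 a2 a3]] := step d (R'R _ dR').
  have dD : d \in component e R d by rewrite inE.
  have DR' : {subset component e R d <= R'}.
    move=> z; rewrite inE => dz; apply: (connect_ind (P := mem R')) dz dR'.
    by move=> u v uR /andP[/andP[_ vR] uv]; apply: cl uv.
  have [|||L2 [b1 b2 b3]] := IHm (R' :\: component e R d).
  - rewrite -ltnS; apply: leq_trans szR; apply: proper_card.
    apply/properP; split; first exact: subsetDl.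
    by exists d; rewrite // inE dD.
  - by move=> z; rewrite inE => /andP[_ /R'R].
  - move=> a b /setDP[aR aD] bR ab.
    rewrite in_setD (cl a) // andbT; apply: contra aD => bD.
    by apply: (component_step (R'R _ dR') bD (R'R _ aR)); rewrite es.
  exists (L1 ++ L2); split; first by rewrite all_cat a1.
    by rewrite /ends map_cat flatten_cat all_cat; apply/andP.
  rewrite /inner map_cat flatten_cat.
  apply: perm_trans (perm_cat a3 b3) _; apply: uniq_perm; rewrite ?enum_uniq //.
    rewrite cat_uniq !enum_uniq andbT /=; apply/hasPn => z.
    by rewrite !mem_enum inE => /andP[].
  move=> z; rewrite mem_cat !mem_enum in_setD.
  by case: (boolP (z \in component e R d)) => //= /DR'.
have [|L [L1 L2 L3]] := trails _ R (leqnn _) (fun z => id) => //.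
have [||||||||t [t1 t2 t3 t4 t5]] := @combine _ e S es x p y L.
- by move: cp; rewrite /= rcons_path => /andP[].
- by move: cp; rewrite /= rcons_path => /andP[].
- by [].
- by [].
- by [].
- by move=> z /(allP L2) /andP[].
- by [].
- by apply/negP => /(allP L2); rewrite /P /= eqxx andbF.
exists t; split=> //; apply: perm_trans t5 _.
apply: perm_trans (perm_cat (perm_refl _) L3) _.
apply: uniq_perm; rewrite ?enum_uniq //.
  rewrite cat_uniq up enum_uniq andbT; apply/hasPn => z.
  by rewrite mem_enum => /RC.
move=> z; rewrite mem_cat !mem_enum; apply/orP/idP => [[/pS|/RS] //|zS].
by case: (boolP (z \in x :: p)) => [|/(SR _ zS)]; [left | right].
Qed.

End Fleischner.

(** * Hamiltonian paths in the cube *)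

Section Cube.
Variable H : sgraph.
Let e := @adj H.

Lemma power_adj_walk n (a : H) p : path e a p -> size p <= n -> a != last a p ->
  @power_adj H n a (last a p).
Proof.
move=> ap pn anl; rewrite /power_adj /= anl /dist_le /dist.
have cab : connect e a (last a p) by apply/connectP; exists p.
case: (decP _) => [cab'|/(_ cab)//]; case: ex_minnP => m _ mP.
suff [k kn Pk] : exists2 k, k <= n & has_path a (last a p) k.
  exact: leq_trans (mP _ Pk) kn.
case: (shortenP ap) => q aq uq qp; exists (size q).
  by apply: leq_trans pn; apply: uniq_leq_size => //; case/andP: uq.
by apply/existsP; exists (in_tuple q); rewrite aq uq eqxx.
Qed.

(** [S] splits into the component [Sy] of a neighbour [y] of [x] in [S :\ x] and a connected rest
    containing [x]. The paths from [x] and from [y] end within distance 1 of their starts, so their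
    far ends are at distance at most 1 + 1 + 1; the second path, reversed, then ends at [y]. *)
Lemma cube_path n (S : {set H}) x : #|S| <= n -> conn e S -> x \in S ->
  exists s, [/\ perm_eq (x :: s) (enum S), path (@power_adj H 3) x s
    & (last x s == x) || e x (last x s)].
Proof.
have es : symmetric e := @adj_sym H.
elim: n S x => [|n IH] S x szS cS xS.
  by move: szS; rewrite leqn0 cards_eq0 => /eqP S0; rewrite S0 inE in xS.
have [S1|S1] := leqP #|S| 1.
  exists [::]; split=> //=; last by rewrite eqxx.
  suff -> : S = [set x] by rewrite enum_set1.
  by apply/esym/eqP; rewrite eqEcard sub1set xS cards1.
have [y yS xy] := neighbours cS xS S1.
have [yx yS'] : y != x /\ y \in S by move: yS; rewrite !inE => /andP.
set Sy := component e (S :\ x) y.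
have ySy : y \in Sy by rewrite inE.
have SyS : {subset Sy <= S :\ x} by apply/subsetP/componentS.
have cSy : conn e Sy by apply: component_conn.
have stp a b : a \in Sy -> b \in S :\ x -> e a b -> b \in Sy by exact: component_step.
clearbody Sy.
have xSy : x \notin Sy by apply/negP => /SyS; rewrite !inE eqxx.
have xSx : x \in S :\: Sy by rewrite inE xSy.
have cSx : conn e (S :\: Sy).
  have toX z : z \in S :\: Sy -> connect (erel e (S :\: Sy)) z x.
    move=> zSx; have /setDP[zS _] := zSx.
    have /connectP[q rq lq] := cS z x zS xS.
    elim: q z zSx {zS} rq lq => [|u q IHq] z zSx /=; first by move=> _ ->.
    case/andP=> /andP[/andP[zS uS] zu] uq lq.
    have [->|zx] := eqVneq z x; first exact: connect0.
    have uSx : u \in S :\: Sy.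
      rewrite inE uS andbT; apply: contraL zSx => uSy; rewrite inE negb_and negbK.
      by rewrite (stp u) // ?inE ?zx // es.
    apply: connect_trans (connect1 _) (IHq u uSx uq lq).
    by rewrite /erel /= zSx uSx.
  move=> a b aX bX; apply: connect_trans (toX a aX) _.
  by rewrite (sym_connect_sym (erel_sym _ es)) toX.
have szD : #|S| = #|Sy| + #|S :\: Sy|.
  rewrite -(cardsID Sy) (setIidPr _) //; apply/subsetP => z /SyS.
  by rewrite inE => /andP[].
have Sy0 : 0 < #|Sy| by apply/card_gt0P; exists y.
have Sx0 : 0 < #|S :\: Sy| by apply/card_gt0P; exists x.
have [|s1 [p1 q1 l1]] := IH (S :\: Sy) x _ cSx xSx.
  by move: szS Sy0; rewrite szD; clear; lia.
have [|s2 [p2 q2 l2]] := IH Sy y _ cSy ySy.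
  by move: szS Sx0; rewrite szD; clear; lia.
exists (s1 ++ rev (y :: s2)); split.
- rewrite -cat_cons; apply/permP=> P; move/permP/(_ P): p1; move/permP/(_ P): p2.
  rewrite count_cat count_rev => -> ->; rewrite -count_cat.
  move: P; apply/permP; apply: uniq_perm; rewrite ?enum_uniq //.
    rewrite cat_uniq !enum_uniq andbT /=; apply/hasPn => z.
    by rewrite !mem_enum inE => ->.
  move=> z; rewrite mem_cat !mem_enum inE; case: (boolP (z \in Sy)) => [/SyS|] /=.
    by rewrite inE => /andP[_ ->].
  by rewrite orbF.
- rewrite cat_path q1 /=.
  have sr := @sorted_rev _ (@power_adj H 3) (y :: s2) (@power_adj_sym H 3).
  rewrite /= q2 in sr; rewrite lastI rev_rcons /= in sr *; rewrite sr andbT.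
  have l1S : last x s1 \in S :\: Sy.
    by rewrite -mem_enum -(perm_mem p1) mem_last.
  have l2S : last y s2 \in Sy by rewrite -mem_enum -(perm_mem p2) mem_last.
  have ne : last x s1 != last y s2.
    by apply: contraTneq l1S => ->; rewrite inE l2S.
  (* The walk goes through [x] and [y]; a far end that coincides with its start is not listed
     twice. *)
  pose w1 := if last x s1 == x then [::] else [:: x].
  pose w2 := if last y s2 == y then [::] else [:: last y s2].
  have E : last (last x s1) (w1 ++ y :: w2) = last y s2.
    by rewrite last_cat /= /w2; case: eqP => //= ->.
  rewrite -E; apply: power_adj_walk; rewrite ?E //.
    rewrite cat_path /w1 /w2; case: eqP l1 => [->|_] /= l1; rewrite ?(es _ x) ?l1 xy /=.
      by case: eqP l2 => //= _ ->.
    by case: eqP l2 => //= _ ->.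
  by rewrite size_cat /w1 /w2; do 2 case: ifP.
- by rewrite last_cat rev_cons last_rcons xy orbT.
Qed.

End Cube.

(** * Adding a leaf to the exponent *)

Section TwoRegular.
Variable T : finType.

Definition two_regular (F : rel T) := forall a, exists b c,
  b != c /\ forall d, F a d = (d == b) || (d == c).

Lemma two_regular3 F a b c d : two_regular F -> F a b -> F a c -> F a d ->
  [|| b == c, b == d | c == d].
Proof.
move=> Fr; have [b' [c' [_ Fa]]] := Fr a; rewrite !Fa.
by do 3 case/orP=> /eqP->; rewrite !eqxx ?orbT.
Qed.

Lemma next2_neq (s : seq T) a : uniq s -> 2 < size s -> a \in s ->
  next s (next s a) != a.
Proof.
move=> us ss /rot_to[i s' E].
rewrite -!(next_rot i us) E.
have : uniq (a :: s') by rewrite -E rot_uniq.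
have : 2 < size (a :: s') by rewrite -E size_rot.
case: s' {E} => [|b [|c s']] //= _; rewrite !inE !negb_or => /and3P[/and3P[ab ac _] _ _].
by rewrite eqxx [b == a]eq_sym (negPf ab) eqxx eq_sym.
Qed.

Lemma next_neq_prev (s : seq T) a : uniq s -> 2 < size s -> a \in s ->
  next s a != prev s a.
Proof.
move=> us ss sa; have := next2_neq us ss (_ : prev s a \in s).
by rewrite next_prev // mem_prev; apply.
Qed.

Lemma maximal_path (F : rel T) n : forall x p, path F x p -> uniq (x :: p) ->
  #|T| <= size p + n -> exists x p, [/\ path F x p, uniq (x :: p)
    & forall b, F (last x p) b -> b \in x :: p].
Proof.
elim: n => [|n IH] x p xp up sz.
  have := max_card (mem (x :: p)); rewrite (card_uniqP up) => h.
  by have := leq_trans h sz; rewrite addn0 ltnn.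
have [/existsP[b /andP[lb bp]]|] := boolP [exists b, F (last x p) b && (b \notin x :: p)].
  apply: (IH x (rcons p b)).
  - by rewrite rcons_path xp.
  - by rewrite -rcons_cons rcons_uniq bp.
  - by rewrite size_rcons addSnnS.
rewrite negb_exists => /forallP nb; exists x, p; split=> // b lb.
by have := nb b; rewrite lb /= negbK.
Qed.

(** The last vertex of a maximal path has a second neighbour, which lies on the path. Inner vertices
    already have both neighbours there, so it is the first vertex and the path closes up. No edge
    leaves this cycle, which therefore contains everything. *)
Lemma two_regular_cycle (F : rel T) (x0 : T) : symmetric F -> irreflexive F ->
  two_regular F -> (forall a b, connect F a b) ->
  exists c, [/\ cycle F c, uniq c, forall a, a \in c, 2 < size c
    & forall a b, F a b -> next c a = b \/ next c b = a].
Proof.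
move=> Fs Fi Fr Fc.
have [x [p [xp up lp]]] : exists x p, [/\ path F x p, uniq (x :: p)
    & forall b, F (last x p) b -> b \in x :: p].
  by apply: (@maximal_path F #|T| x0 [::]); rewrite //= add0n.
case/lastP: p xp up lp => [|p l] xp up lp.
  have [b [c [bc lE]]] := Fr x.
  have := lp b; have := lp c; rewrite /= !lE !eqxx orbT !inE.
  move=> /(_ isT)/eqP E1 /(_ isT)/eqP E2; by rewrite E1 E2 eqxx in bc.
rewrite last_rcons in lp.
have pl : F (last x p) l by move: xp; rewrite rcons_path => /andP[].
have [y [Fly yn]] : exists y, F l y /\ y != last x p.
  have [b [c [bc lE]]] := Fr l.
  have [E|bl] := eqVneq b (last x p); last by exists b; rewrite lE eqxx.
  by exists c; rewrite lE eqxx orbT -E eq_sym.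
have ly : l != y by apply: contraTneq Fly => ->; rewrite Fi.
have yx : y = x.
  have := lp y Fly; rewrite inE mem_rcons inE (eq_sym y l) (negPf ly).
  case/orP=> [/eqP//|] /= yp.
  case/splitPr: yp xp up pl yn => p1 p2; case: p2 => [|b p2].
    by rewrite last_cat /= eqxx.
  move=> xp up _ _; have := xp; rewrite rcons_cat cat_path /= => /and4P[_ ay yb _].
  have := two_regular3 Fr (_ : F y (last x p1)) yb (_ : F y l).
  rewrite Fs ay Fs Fly => /(_ isT isT).
  move: up; rewrite rcons_cat -cat_cons [x :: p1]lastI cat_rcons cat_uniq.
  case/and3P=> _ _ /=; rewrite !(inE, mem_rcons) !negb_or.
  case/and3P=> [/and4P[_ ab al _]] _ /andP[/andP[bl _] _].
  by rewrite (negPf ab) (negPf al) (negPf bl).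
have lx : F l x by rewrite -yx.
pose c := x :: rcons p l.
have cc : cycle F c by rewrite /c /= rcons_path xp last_rcons.
have sc : 2 < size c.
  rewrite /c /= size_rcons !ltnS; case: (p) yn => //=.
  by rewrite yx eqxx.
have nP a b : a \in c -> F a b -> b = next c a \/ b = prev c a.
  move=> ac ab; have np := next_neq_prev up sc ac.
  have := two_regular3 Fr ab (next_cycle cc ac) (_ : F a (prev c a)).
  rewrite Fs (prev_cycle cc ac) => /(_ isT).
  by rewrite (negPf np) orbF => /orP[]/eqP; [left | right].
have call a : a \in c.
  apply: (connect_ind (P := [pred z | z \in c])) (Fc x a) _; last by rewrite /= inE eqxx.
  by move=> u v uc /(nP u v uc)[]->; [exact: (etrans (mem_next c u) uc) | exact: (etrans (mem_prev c u) uc)].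
exists c; split=> // a b ab.
by case: (nP a b (call a) ab) => ->; [left | right; rewrite next_prev].
Qed.

End TwoRegular.

(** * Exchanging edges between copies and new cycles *)

Section Leaf.
Variables (V U : finType) (q : nat).
Hypothesis q_gt2 : 2 < q.
Let X := 'I_q.
Variables (eV : rel V) (pi : U -> V) (c : seq V).
Hypotheses (eV_sym : symmetric eV) (pi_inj : injective pi) (cc : cycle eV c)
  (uc : uniq c) (call : forall v, v \in c) (sc : 2 < size c).
(* [cut v x]: the copy number [x] of the edge from [v] to [next c v] is removed;
   [rem u x]: the edge from [x] to [x + 1] of the new cycle at [u] is removed. *)
Variables (cut : V -> X -> bool) (rem : U -> X -> bool).
Hypothesis cut_port : forall v x, cut v x ->
  (exists u, v = pi u) /\ (exists u, next c v = pi u).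
(** The two ends of a spoke lose the same number of edges, at most one each, so adding the spoke
    exactly where edges are lost restores degree 2 at both. *)
Hypothesis cut_rem : forall u x,
  cut (pi u) x + cut (prev c (pi u)) x = rem u x + rem u (ord_pred x) /\
  rem u x + rem u (ord_pred x) <= 1.

Notation V' := (V * X + U * X)%type.

Definition leaf_adj : rel V' := fun a b =>
  match a, b with
  | inl (v, x), inl (w, y) => (x == y) && eV v w
  | inl (v, x), inr (u, y) => (x == y) && (v == pi u)
  | inr (u, x), inl (v, y) => (x == y) && (v == pi u)
  | inr (u, x), inr (w, y) => (u == w) && ((y == ordS x) || (x == ordS y))
  end.

Definition leaf_factor : rel V' := fun a b =>
  match a, b with
  | inl (v, x), inl (w, y) =>
      (x == y) && ((w == next c v) && ~~ cut v x || (v == next c w) && ~~ cut w x)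
  | inl (v, x), inr (u, y) | inr (u, y), inl (v, x) =>
      (x == y) && (v == pi u) && (cut v x || cut (prev c v) x)
  | inr (u, x), inr (w, y) =>
      (u == w) && ((y == ordS x) && ~~ rem u x || (x == ordS y) && ~~ rem u y)
  end.

Lemma val_ordS (x : X) : ordS x = (if x.+1 == q then 0 else x.+1) :> nat.
Proof.
case: eqP => /= [->|xq]; first by rewrite modnn.
by rewrite modn_small // ltn_neqAle ltn_ord andbT; apply/eqP.
Qed.

Lemma ordS2_neq (x : X) : ordS x != ord_pred x.
Proof.
apply/eqP=> /(congr1 (@ordS q)); rewrite ord_predK => /(congr1 (@nat_of_ord q)).
rewrite !val_ordS; have := ltn_ord x; move: q_gt2.
by case: eqP; case: eqP; clear; lia.
Qed.

Lemma eq_ordS (x y : X) : (x == ordS y) = (y == ord_pred x).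
Proof. by rewrite eq_sym (can2_eq (@ordSK q) (@ord_predK q)). Qed.

Lemma eq_next v w : (v == next c w) = (w == prev c v).
Proof. by rewrite eq_sym (can2_eq (prev_next uc) (next_prev uc)). Qed.

Lemma leaf_factor_sym : symmetric leaf_factor.
Proof.
move=> [[v x]|[u x]] [[w y]|[u' y]] //=; rewrite eq_sym //.
  by case: eqP => //= ->; rewrite orbC.
by case: eqP => //= ->; rewrite orbC.
Qed.

Lemma leaf_factor_irr : irreflexive leaf_factor.
Proof.
move=> [[v x]|[u x]] /=; rewrite eqxx /= orbb; last first.
  case: eqP => //= /esym/(congr1 (@nat_of_ord q)); rewrite val_ordS.
  have := ltn_ord x; move: q_gt2; by case: eqP; clear; lia.
case: eqP => //= E; have := next2_neq uc sc (call v).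
by rewrite -!E eqxx.
Qed.

Lemma leaf_factor_sub a b : leaf_factor a b -> leaf_adj a b.
Proof.
case: a b => [[v x]|[u x]] [[w y]|[u' y]] /=.
- case/andP=> ->; case/orP=> /andP[/eqP-> _]; first exact: next_cycle.
  by rewrite /= eV_sym; apply: next_cycle.
- by case/andP.
- by case/andP; rewrite (eq_sym y).
- by case/andP=> ->; case/orP=> /andP[-> _]; rewrite ?orbT.
Qed.

Lemma leaf_two_regular : two_regular leaf_factor.
Proof.
move=> [[v x]|[u x]].
  have nE d : leaf_factor (inl (v, x)) d = match d with
    | inl (w, y) => (x == y) && ((w == next c v) && ~~ cut v x ||
                                 (w == prev c v) && ~~ cut (prev c v) x)
    | inr (u, y) => (x == y) && (v == pi u) && (cut v x || cut (prev c v) x) end.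
    case: d => [[w y]|[u y]] //=; rewrite (eq_next v); congr (_ && _).
    by congr (_ || _); case: (w =P prev c v) => [->|].
  have [[u vu]|nov] : (exists u, v = pi u) \/ (cut v x = false /\ cut (prev c v) x = false).
  - case c1: (cut v x); first by left; have [] := cut_port c1.
    case c2: (cut (prev c v) x); last by right.
    by left; have [_] := cut_port c2; rewrite next_prev.
  - have [] := cut_rem u x; rewrite -vu.
    case c1: (cut v x); case c2: (cut (prev c v) x) => // E1 E2.
    + by exfalso; move: E1 E2; clear; lia.
    + exists (inl (prev c v, x)), (inr (u, x)); split=> // d; rewrite nE c1 c2.
      case: d => [[w y]|[u' y]] /=; rewrite ?andbF ?andbT ?orbF ?orbT /=.
        by rewrite (eq_sym x) /= andbC.
      by rewrite vu (inj_eq pi_inj) (eq_sym x) (eq_sym u) andbC.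
    + exists (inl (next c v, x)), (inr (u, x)); split=> // d; rewrite nE c1 c2.
      case: d => [[w y]|[u' y]] /=; rewrite ?andbF ?andbT ?orbF ?orbT /=.
        by rewrite (eq_sym x) /= andbC.
      by rewrite vu (inj_eq pi_inj) (eq_sym x) (eq_sym u) andbC.
    + exists (inl (next c v, x)), (inl (prev c v, x)); split.
        by apply: contra (next_neq_prev uc sc (call v)) => /eqP[->].
      move=> d; rewrite nE c1 c2.
      case: d => [[w y]|[u' y]] /=; rewrite ?andbF ?andbT ?orbF ?orbT //=.
      by rewrite (eq_sym x) -andb_orl andbC.
  - case: nov => c1 c2; exists (inl (next c v, x)), (inl (prev c v, x)); split.
      by apply: contra (next_neq_prev uc sc (call v)) => /eqP[->].
    move=> d; rewrite nE c1 c2.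
    case: d => [[w y]|[u' y]] /=; rewrite ?andbF ?andbT ?orbF ?orbT //=.
    by rewrite (eq_sym x) -andb_orl andbC.
have nE d : leaf_factor (inr (u, x)) d = match d with
  | inl (v, y) => (x == y) && (v == pi u) && (0 < rem u x + rem u (ord_pred x))
  | inr (w, y) => (u == w) && ((y == ordS x) && ~~ rem u x ||
      (y == ord_pred x) && ~~ rem u (ord_pred x)) end.
  case: d => [[v y]|[w y]] /=.
    rewrite (eq_sym y); case: eqP => //= <-; case: eqP => //= ->.
    by have [<- _] := cut_rem u x; do 2 case: (cut _ _).
  rewrite (eq_ordS x); congr (_ && (_ || _)).
  by case: (y =P ord_pred x) => [->|].
have [_] := cut_rem u x; case r1: (rem u x); case r2: (rem u (ord_pred x)) => // _.
- exists (inr (u, ord_pred x)), (inl (pi u, x)); split=> // d; rewrite nE r1 r2.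
  case: d => [[v y]|[w y]] /=; rewrite ?andbF ?andbT ?orbF ?orbT /=.
    by rewrite (eq_sym x) andbC.
  by rewrite (eq_sym u).
- exists (inr (u, ordS x)), (inl (pi u, x)); split=> // d; rewrite nE r1 r2.
  case: d => [[v y]|[w y]] /=; rewrite ?andbF ?andbT ?orbF ?orbT /=.
    by rewrite (eq_sym x) andbC.
  by rewrite (eq_sym u).
- exists (inr (u, ordS x)), (inr (u, ord_pred x)); split.
    by apply: contra (ordS2_neq x) => /eqP E; apply/eqP; congruence.
  move=> d; rewrite nE r1 r2.
  case: d => [[v y]|[w y]] /=; rewrite ?andbF ?andbT ?orbF ?orbT //=.
  by rewrite (eq_sym u) -andb_orr.
Qed.

Lemma leaf_cycle (a0 : V') : (forall a b, connect leaf_factor a b) ->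
  exists c', [/\ cycle leaf_adj c', uniq c', forall a, a \in c', 2 < size c'
    & forall u x, ~~ rem u x -> next c' (inr (u, x)) = inr (u, ordS x) \/
        next c' (inr (u, ordS x)) = inr (u, x)].
Proof.
move=> con.
have [c' [c1 c2 c3 c4 c5]] :=
  two_regular_cycle a0 leaf_factor_sym leaf_factor_irr leaf_two_regular con.
exists c'; split=> //.
  by apply: sub_cycle c1 => a b; apply: leaf_factor_sub.
by move=> u x rx; apply: c5; rewrite /= !eqxx rx.
Qed.

(** In each new cycle the removed edges start at positions of one parity. The edges starting at the
    other parity survive, and for even [q] they match all its vertices. *)
Lemma leaf_matching c' (b : U -> bool) : ~~ odd q ->
  (forall u x, rem u x -> odd x = b u) ->
  (forall u x, ~~ rem u x -> next c' (inr (u, x) : V') = inr (u, ordS x) \/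
        next c' (inr (u, ordS x)) = inr (u, x)) ->
  exists mu : U * X -> U * X, involutive mu /\
    forall w, next c' (inr w) = inr (mu w) \/ next c' (inr (mu w)) = inr w.
Proof.
move=> qe remb nc.
have oddS (x : X) : odd (ordS x) = ~~ odd x.
  by rewrite val_ordS; case: eqP => //= E; rewrite -[~~ odd x]/(odd x.+1) E (negPf qe).
have oddP (x : X) : odd (ord_pred x) = ~~ odd x.
  by rewrite -{2}(ord_predK x) oddS negbK.
exists (fun w : U * X => (w.1, if odd w.2 == b w.1 then ord_pred w.2 else ordS w.2)).
split=> [[u x]|[u x]] /=.
  case: (odd x =P b u) => xb; rewrite ?oddS ?oddP.
    by rewrite -xb; case: (odd x); rewrite /= ord_predK.
  by move: xb; case: (odd x); case: (b u) => //= _; rewrite ordSK.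
have nrem (y : X) : odd y != b u -> ~~ rem u y by apply: contra => /remb->.
case: ifPn => xb; last exact: nc (nrem _ xb).
have := nc u (ord_pred x); rewrite ord_predK => /(_ _)[|E|E]; [|by right|by left].
by apply: nrem; rewrite oddP -(eqP xb); case: (odd x).
Qed.

Lemma ring_arc u (i j : X) : i <= j ->
  (forall y : X, i <= y < j -> ~~ rem u y) ->
  connect leaf_factor (inr (u, i)) (inr (u, j)).
Proof.
move: {2}(j - i) (erefl (j - i)) => n; elim: n i => [|n IH] i ji ij nr.
  have -> : i = j by apply: val_inj => /=; move: ji ij; clear; lia.
  exact: connect0.
have Si : ordS i = i.+1 :> nat.
  rewrite val_ordS; case: eqP => // E; have := ltn_ord j; move: ji ij E; clear; lia.
apply: connect_trans (connect1 _) (IH (ordS i) _ _ _).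
- by rewrite /= !eqxx nr // leqnn; move: ji; clear; lia.
- by rewrite Si; move: ji; clear; lia.
- by rewrite Si; move: ji; clear; lia.
- by move=> y; rewrite Si => /andP[iy yj]; apply: nr; rewrite (ltnW iy).
Qed.

Lemma ring_wrap u (i j : X) : i.+1 = q -> j = 0 :> nat -> ~~ rem u i ->
  connect leaf_factor (inr (u, i)) (inr (u, j)).
Proof.
move=> iq j0 ri; have -> : j = ordS i.
  by apply: val_inj; rewrite /= -[_ %% q]/(nat_of_ord (ordS i)) val_ordS iq eqxx.
by apply: connect1; rewrite /= !eqxx ri.
Qed.

Lemma port_exit u x : cut (pi u) x || cut (prev c (pi u)) x ->
  connect leaf_factor (inl (pi u, x)) (inr (u, x)).
Proof. by move=> cx; apply: connect1; rewrite /= !eqxx cx. Qed.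

Lemma track v x : ~~ cut v x ->
  connect leaf_factor (inl (v, x)) (inl (next c v, x)).
Proof. by move=> cx; apply: connect1; rewrite /= !eqxx cx. Qed.

End Leaf.

(** * The first leaf *)

Section Ring.
Variable q : nat.
Hypothesis q_gt2 : 2 < q.
Let X := 'I_q.

Definition ring_adj : rel X := [rel x y | (y == ordS x) || (x == ordS y)].

Lemma ring_adj_sym : symmetric ring_adj.
Proof. by move=> x y; rewrite /ring_adj /= orbC. Qed.

Lemma iter_ordS (x y : X) : exists n, y = iter n (@ordS q) x.
Proof.
exists (y + q - x); apply: val_inj => /=.
have E n : nat_of_ord (iter n (@ordS q) x) = (x + n) %% q.
  elim: n => [|n IH]; first by rewrite addn0 modn_small.
  by rewrite iterS /= IH -addn1 modnDml addn1 addnS.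
rewrite E; have -> : x + (y + q - x) = y + q.
  by have := ltn_ord x; clear; lia.
by rewrite modnDr modn_small.
Qed.

Lemma iter_ord_pred (x y : X) : exists n, y = iter n (@ord_pred q) x.
Proof.
have [n ->] := iter_ordS y x; exists n.
by elim: n => // n IH; rewrite iterSr iterS ordSK -IH.
Qed.

Lemma ring_cycle : exists c : seq X, [/\ cycle ring_adj c, uniq c,
  forall x, x \in c, 2 < size c & forall x, next c x = ordS x].
Proof.
have x0 : X by exact: Ordinal (ltnW (ltnW q_gt2)).
pose c := orbit (@ordS q) x0.
have cc : fcycle (@ordS q) c := cycle_orbit (@ordS_inj q) x0.
have call x : x \in c.
  have [n ->] := iter_ordS x0 x.
  by rewrite -fconnect_orbit fconnect_iter.
have uc : uniq c := orbit_uniq _ _.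
exists c; split=> //.
- by apply: sub_cycle cc => x y /eqP<-; rewrite /ring_adj /= eqxx.
- have /card_uniqP <- := uc.
  by rewrite (eq_card (B := X)) ?card_ord // => x; rewrite call.
- by move=> x; apply: nextE.
Qed.

(* Track [x] is cut after position [x], so that the ring attached to the port
   [u] is entered at [u - 1] and [u]: the cuts form a staircase. *)
Lemma ring_leaf : ~~ odd q -> exists c' mu,
  [/\ cycle (@leaf_adj X X q ring_adj id) c', uniq c', forall a, a \in c', 2 < size c'
    & involutive mu /\ forall w,
      next c' (inr w) = inr (mu w) \/ next c' (inr (mu w)) = inr w].
Proof.
move=> qe; have [c [cc uc call sc nc]] := ring_cycle.
have pc x : prev c x = ord_pred x.
  by rewrite -{1}(ord_predK x) -nc prev_next.
pose cut (v x : X) := x == v; pose rem (u x : X) := u == ordS x.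
have cut_port v x : cut v x -> (exists u, v = id u) /\ (exists u, next c v = id u).
  by split; eexists.
have cut_rem u x : cut (id u) x + cut (prev c (id u)) x = rem u x + rem u (ord_pred x)
   /\ rem u x + rem u (ord_pred x) <= 1.
  rewrite /cut /rem pc ord_predK eq_sym addnC.
  have -> : (x == ord_pred u) = (u == ordS x) by rewrite eq_ordS.
  split=> //; case: (u =P x) => [->|_]; last by case: (_ == _).
  case: (x =P ordS x) => // /(congr1 (@nat_of_ord q)); rewrite val_ordS.
  by have := ltn_ord x; move: q_gt2; case: eqP; clear; lia.
pose F := @leaf_factor X X q id c cut rem.
have Fs : symmetric F by exact: leaf_factor_sym.
have FC := sym_connect_sym Fs.
have trk x v : connect F (inl (x, x)) (inl (v, x)).
  have [n ->] := iter_ord_pred x v; elim: n => [|n IH]; first exact: connect0.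
  set w := iter n _ _ in IH *; rewrite iterS -/w.
  have [E|E] := eqVneq x (ord_pred w); first by rewrite -E connect0.
  apply: connect_trans IH _; rewrite FC -{2}(ord_predK w) -nc.
  by apply: track => //.
have rng u w : connect F (inr (u, u)) (inr (u, w)).
  have [n ->] := iter_ordS u w; elim: n => [|n IH]; first exact: connect0.
  set z := iter n _ _ in IH *; rewrite iterS -/z.
  have [E|E] := eqVneq u (ordS z); first by rewrite -E connect0.
  by apply: connect_trans IH (connect1 _); rewrite /= !eqxx /rem E.
have ex u x : cut u x || cut (ord_pred u) x -> connect F (inl (u, x)) (inr (u, x)).
  by rewrite -pc => h; apply: (@port_exit X X q id c cut rem u x h).
(* The ring [u] meets the track [u] at position [u] and, by [dn], the track [u - 1] at position
   [u - 1]; it thus links consecutive tracks. *)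
have up u v w : connect F (inl (v, u)) (inr (u, w)).
  apply: connect_trans (rng u w); rewrite FC; apply: connect_trans (trk u v).
  by rewrite FC; apply: ex; rewrite /cut eqxx.
have dn u v w : connect F (inl (v, ord_pred u)) (inr (u, w)).
  apply: (@connect_trans _ _ (inr (u, ord_pred u))).
    apply: connect_trans (ex u (ord_pred u) _); last by rewrite /cut eqxx orbT.
    by rewrite FC; apply: connect_trans (trk _ _); rewrite FC.
  by apply: connect_trans (rng u w); rewrite FC.
have all x y v v' : connect F (inl (v, x)) (inl (v', y)).
  have [n ->] := iter_ordS x y; elim: n v' => [|n IH] v'.
    by apply: connect_trans (trk x v'); rewrite FC.
  set z := iter n _ _ in IH *; rewrite iterS -/z.
  apply: connect_trans (IH v') _.
  rewrite -{1}(ordSK z); apply: connect_trans (dn (ordS z) v' z) _.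
  by rewrite FC.
have con a b : connect F a b.
  case: a b => [[v x]|[u x]] [[v' y]|[u' y]].
  - exact: all.
  - exact: connect_trans (all x u' v v) (up u' v y).
  - by rewrite FC; apply: connect_trans (all y u v' v') (up u v' x).
  - rewrite FC; apply: connect_trans (up u u x); rewrite FC.
    exact: connect_trans (all u u' u u) (up u' u y).
have x0 : X by exact: Ordinal (ltnW (ltnW q_gt2)).
have [c' [c1 c2 c3 c4 c5]] := leaf_cycle q_gt2 ring_adj_sym (@inj_id X) cc uc call sc
  cut_port cut_rem (inl (x0, x0)) con.
have [||mu [m1 m2]] := @leaf_matching X X q rem c' (fun u => odd (ord_pred u)) qe.
- by move=> u x /eqP->; rewrite ordSK.
- exact: c5.
by exists c', mu.
Qed.

End Ring.

Lemma next_nth_uniq (T : eqType) (x0 : T) (s : seq T) i : uniq s -> i < size s ->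
  next s (nth x0 s i) = nth x0 s (if i.+1 == size s then 0 else i.+1).
Proof.
move=> us si; rewrite next_nth mem_nth // index_uniq //.
case: s us si => // y p _ si; case: eqP => [[E]|E]; first by rewrite nth_default /= ?E.
by rewrite /=; apply: set_nth_default; move: si E => /=; clear; lia.
Qed.

(** * Connecting all copies through the pairs *)

Section Ranks.
Variables q k : nat.
Hypotheses (q_ge4 : 4 <= q) (q_even : ~~ odd q) (k_even : ~~ odd k) (qk : q <= k).

(* The matched pairs of attachment vertices are numbered from [0] to [k - 1]
   along the Hamiltonian cycle. Both new cycles of the pair number [j] lose the
   edges [{x, x + 1}] with [removed j x], and the copies [x] of the edge joining
   the pair are removed when [exits j x]. The last pair exchanges four copies,
   joined two by two; every other pair only [dom j] and [dom j + 1]. The values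
   of [dom] alternate between [2] and [1] an odd number of times, which connects
   the copies [0] to [3], and then run through [3, ..., q - 2], each of them
   connecting one more copy. *)
Definition zig := k + 3 - q.

Definition dom j := if j < zig then (if odd j then 1 else 2) else 3 + (j - zig).

Definition removed j x := if j.+1 == k then (x == 0) || (x == 2) else x == dom j.

Definition exits j x := if j.+1 == k then x < 4 else (x == dom j) || (x == (dom j).+1).

Lemma dom_gt0 j : 0 < dom j.
Proof. by rewrite /dom; case: ifP => // _; case: ifP. Qed.

Lemma dom_bound j : j.+1 < k -> (dom j).+1 < q.
Proof.
rewrite /dom /zig; case: ifP => [_|]; first by case: ifP; move: q_ge4; clear; lia.
by move: q_ge4 qk; clear; lia.
Qed.

Lemma exits_removed j x : j < k -> x < q ->
  nat_of_bool (exits j x) = removed j x + removed j (if x == 0 then q.-1 else x.-1) /\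
  removed j x + removed j (if x == 0 then q.-1 else x.-1) <= 1.
Proof.
move=> jk xq; rewrite /exits /removed; case: eqP => jk1.
  by case: eqP => [->|]; move: q_ge4 xq; clear; lia.
have j1 : j.+1 < k by rewrite ltn_neqAle jk andbT; apply/eqP.
move: (dom_bound j1) (dom_gt0 j); move: (dom j) => d dq d0.
by case: x xq => [|x] xq /=; move: d0 dq; clear; lia.
Qed.

(* [M j x]: the copy [x] of the arc of the cycle that ends at the pair [j] is
   connected to the copy [0] of the first arc. *)
Variable M : nat -> nat -> Prop.
Hypothesis straight : forall j x, j.+1 < k -> x < q -> ~~ exits j x ->
  (M j x <-> M j.+1 x).
Hypothesis wrap : forall x, x < q -> ~~ exits k.-1 x -> (M k.-1 x <-> M 0 x).
(** [above] and [below] are the links through the new cycles at the first and at the second vertex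
    of the pair. At the last pair, removing {0, 1} and {2, 3} leaves the arc {1, 2} and the arc from
    3 through [q - 1] to 0, whence the links of 1 with 2 and of 3 with 0. *)
Hypothesis above : forall j, j.+1 < k -> (M j (dom j) <-> M j (dom j).+1).
Hypothesis below : forall j, j.+1 < k -> (M j.+1 (dom j) <-> M j.+1 (dom j).+1).
Hypothesis above12 : M k.-1 1 <-> M k.-1 2.
Hypothesis above30 : M k.-1 3 <-> M k.-1 0.
Hypothesis below12 : M 0 1 <-> M 0 2.
Hypothesis below30 : M 0 3 <-> M 0 0.
Hypothesis M00 : M 0 0.

Lemma zig_odd : odd zig. Proof. by move: q_even k_even qk; rewrite /zig; clear; lia. Qed.

Lemma zig_lt : zig < k. Proof. by move: q_ge4 qk; rewrite /zig; clear; lia. Qed.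

Lemma dom_zig j : j < zig -> dom j = if odd j then 1 else 2.
Proof. by rewrite /dom => ->. Qed.

Lemma dom_after j : zig <= j -> dom j = 3 + (j - zig).
Proof. by rewrite /dom ltnNge => ->. Qed.

Lemma nexits j x : j.+1 < k -> x != dom j -> x != (dom j).+1 -> ~~ exits j x.
Proof. by rewrite /exits => jk h1 h2; rewrite (ltn_eqF jk) negb_or h1. Qed.

(** With [dom] equal to 1 on one side of a block and 2 on the other, the links {1, 2} and {2, 3}
    chain the copies 1, 2, 3. One of these always enters the block straight, and so does copy 0. In
    block 0 the last pair provides {1, 2} and {3, 0}, which is why [dom] starts with 2. *)
Lemma zig_block j : j < zig -> [/\ M j 0, M j 1, M j 2 & M j 3].
Proof.
have zk := zig_lt; have q4 := q_ge4.
elim: j => [|j IH] jz.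
  have j1 : 0.+1 < k by move: jz zk q4 qk; clear; lia.
  have M3 := below30.2 M00.
  have M2 : M 0 2 by have := above j1; rewrite dom_zig //= => ->.
  by split=> //; apply/below12.
have [m0 m1 m2 m3] := IH (ltnW jz).
have jk : j.+1 < k by apply: leq_ltn_trans zk; apply: ltnW.
have jk2 : j.+2 < k by apply: leq_trans zk.
have dj := dom_zig (ltnW jz); have dj1 := dom_zig jz.
have ab := above jk2; have bl := below jk.
rewrite dj1 /= in ab; rewrite dj in bl.
have st x : x < 4 -> x != dom j -> x != (dom j).+1 -> M j x -> M j.+1 x.
  move=> x4 h1 h2 mx; apply/(straight jk _ (nexits jk h1 h2)) => //.
  exact: leq_trans q4.
rewrite dj in st.
have s0 : M j.+1 0 by apply: st => //; case: (odd j).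
case oj: (odd j) ab bl st => /= ab bl st.
  by have s3 : M j.+1 3 by [apply: st]; have s2 := ab.2 s3; have s1 := bl.2 s2; split.
have s1 : M j.+1 1 by apply: st.
by have s2 := ab.1 s1; have s3 := bl.1 s2; split.
Qed.

(** After the zigzag the copies 0 and 1 run straight to the last pair, which brings in 2 and 3, and
    these run back. Copy 3 is cut at the pair [zig]; block [zig] gets it from the pair before, where
    [dom] is 2 because [zig] is odd. *)
Lemma low_block j : j < k -> [/\ M j 0, M j 1, M j 2 & M j 3].
Proof.
have zk := zig_lt; have q4 := q_ge4; have zo := zig_odd.
case: (ltnP j zig) => [/zig_block//|].
have z0 : 0 < zig by case: zig zo.
have pz : zig.-1.+1 = zig by rewrite prednK.
have pk : zig.-1.+1 < k by rewrite pz.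
have [m0 m1 m2 m3] : [/\ M zig.-1 0, M zig.-1 1, M zig.-1 2 & M zig.-1 3].
  by apply: zig_block; rewrite pz.
have dz : dom zig.-1 = 2.
  rewrite dom_zig ?pz //; have : odd zig.-1.+1 by rewrite pz.
  by rewrite /=; case: (odd _).
have up x i : x < 3 -> zig <= i -> i.+1 < k -> (M i x <-> M i.+1 x).
  move=> x3 zi ik; apply: straight => //; first by apply: leq_trans x3 (leq_trans _ q4).
  by apply: nexits => //; rewrite dom_after //; move: x3; clear; lia.
have M0 i : zig <= i -> i < k -> M i 0 /\ M i 1.
  elim: i => [|i IH]; first by rewrite leqNgt z0.
  rewrite leq_eqVlt => /orP[/eqP E|zi] ik.
    rewrite -E -pz; split.
      by apply/(straight pk _ _).1 => //; [exact: leq_trans q4 | apply: nexits; rewrite // dz].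
    by apply/(straight pk _ _).1 => //; [exact: leq_trans q4 | apply: nexits; rewrite // dz].
  have [a0 a1] := IH zi (ltnW ik).
  by split; [apply/(up 0 i) | apply/(up 1 i)].
have k1 : k.-1.+1 = k by rewrite prednK //; apply: leq_trans zk.
have zk1 : zig <= k.-1 by rewrite -ltnS k1.
have [l0 l1] : M k.-1 0 /\ M k.-1 1 by apply: M0; rewrite ?k1.
have l2 := above12.1 l1; have l3 := above30.2 l0.
have M2 n i : i + n = k.-1 -> zig <= i -> M i 2.
  elim: n i => [|n IH] i E zi; first by move: E; rewrite addn0 => ->.
  apply/(up 2 i) => //; first by rewrite -k1 -E; clear; lia.
  by apply: IH; [rewrite addSnnS | exact: ltnW].
have M3 n i : i + n = k.-1 -> zig < i -> M i 3.
  elim: n i => [|n IH] i E zi; first by move: E; rewrite addn0 => ->.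
  have ik : i.+1 < k by rewrite -k1 -E; clear; lia.
  apply/(straight ik); first exact: leq_trans q4.
    by apply: nexits => //; rewrite dom_after 1?ltnW //; move: zi; clear; lia.
  by apply: IH; [rewrite addSnnS | exact: ltnW].
move=> zj jk; have [a0 a1] := M0 j zj jk.
have jE : j + (k.-1 - j) = k.-1 by move: jk k1; clear; lia.
have a2 := M2 _ j jE zj; split=> //.
move: zj; rewrite leq_eqVlt => /orP[/eqP E|zj]; last exact: M3 jE zj.
by have := below pk; rewrite dz pz E => <-.
Qed.

(** A copy [x.+1 > 3] can be cut only at the pair [j0] with [dom j0 = x] and at the next one. This
    leaves block [j0.+1] and an arc that ends with block [j0]; the pair [j0] links both to copy
    [x]. *)
Lemma ranks_connected j x : j < k -> x < q -> M j x.
Proof.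
have zk := zig_lt; have q4 := q_ge4.
have k1 : k.-1.+1 = k by rewrite prednK //; apply: leq_trans zk.
elim: x j => [|x IH] j jk xq; first by have [] := low_block jk.
have [x3|x3] := ltnP x 3.
  by have [h0 h1 h2 h3] := low_block jk; case: x {IH xq} x3 => [|[|[|]]].
pose j0 := zig + (x - 3).
have j0k : j0.+1 < k by move: qk q4 xq x3 zk; rewrite /j0 /zig; clear; lia.
have d0 : dom j0 = x by rewrite dom_after /j0; move: x3; clear; lia.
have ab : M j0 x.+1.
  by have := above j0k; rewrite d0 => <-; apply: IH; rewrite ltnW // ltnW.
have bl : M j0.+1 x.+1.
  by have := below j0k; rewrite d0 => <-; apply: IH => //; apply: ltnW.
have nex i : i.+1 < k -> i != j0 -> i != j0.+1 -> ~~ exits i x.+1.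
  move=> ik i0 i1; apply: nexits => //; rewrite /dom /j0 in i0 i1 *;
    by case: (ltnP i zig) => [_|]; [case: (odd i) | ]; move: x3 i0 i1; clear; lia.
have nexk : ~~ exits k.-1 x.+1 by rewrite /exits k1 eqxx -leqNgt ltnS.
have dn n i : i + n = j0 -> M i x.+1.
  elim: n i => [|n IHn] i E; first by move: E; rewrite addn0 => ->.
  have ik : i.+1 < k by move: j0k E; clear; lia.
  apply/(straight ik xq); first by apply: nex => //; move: E; clear; lia.
  by apply: IHn; rewrite addSnnS.
have M0 : M 0 x.+1 by apply: (dn j0); rewrite add0n.
have ML : M k.-1 x.+1 by apply/(wrap xq nexk).
have dn2 n i : i + n = k.-1 -> j0.+1 < i -> M i x.+1.
  elim: n i => [|n IHn] i E ji; first by move: E; rewrite addn0 => ->.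
  have ik : i.+1 < k by rewrite -k1 -E; clear; lia.
  apply/(straight ik xq); first by apply: nex => //; move: ji; clear; lia.
  by apply: IHn; [rewrite addSnnS | exact: ltnW].
case: (ltngtP j j0.+1) => [jj|jj|->//].
  by apply: (dn (j0 - j)); move: jj; clear; lia.
by apply: (dn2 (k.-1 - j)) => //; move: jk k1; clear; lia.
Qed.

End Ranks.

(** * Further leaves *)

Section Step.
Variables (V U : finType) (q : nat).
Hypotheses (q_ge4 : 4 <= q) (q_even : ~~ odd q).
Let X := 'I_q.
Variables (eV : rel V) (pi : U -> V) (c : seq V) (mu : U -> U) (v0 : V).
Hypotheses (eV_sym : symmetric eV) (pi_inj : injective pi) (cc : cycle eV c)
  (uc : uniq c) (call : forall v, v \in c) (sc : 2 < size c)
  (muK : involutive mu)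
  (mu_next : forall u, next c (pi u) = pi (mu u) \/ next c (pi (mu u)) = pi u).

(** Marks the first vertex of each matched pair in the direction of [c], so that every pair is
    counted once. *)
Definition pairs v := [exists u, (v == pi u) && (next c v == pi (mu u))].

Let N := size c.
Let at_ i := nth v0 c i.
Let k := count pairs c.

(** The last and the first entry of the list form a pair, so that block 0 begins at the head of the
    list and this pair has number [k - 1]. *)
Hypothesis pairs_last : pairs (at_ N.-1).
Hypotheses (k_even : ~~ odd k) (qk : q <= k).

Definition rank v := count pairs (take (index v c) c).

Definition port_rank u := if pairs (pi u) then rank (pi u) else rank (prev c (pi u)).

Definition step_cut v (x : X) := pairs v && exits q k (rank v) x.

Definition step_rem u (x : X) := removed q k (port_rank u) x.

Let N0 : 0 < N. Proof. by apply: leq_trans sc. Qed.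

Let N1 : N.-1.+1 = N. Proof. by rewrite prednK. Qed.

Lemma at_index v : at_ (index v c) = v. Proof. by rewrite /at_ nth_index. Qed.

Lemma index_at i : i < N -> index (at_ i) c = i.
Proof. by move=> iN; rewrite /at_ index_uniq. Qed.

Lemma index_lt v : index v c < N. Proof. by rewrite /N index_mem. Qed.

Lemma next_at i : i < N -> next c (at_ i) = at_ (if i.+1 == N then 0 else i.+1).
Proof. exact: next_nth_uniq. Qed.

(** The number of the block of position [i]; it grows just after the first vertex of a pair. *)
Let B i := count pairs (take i c).

Lemma rank_at i : i < N -> rank (at_ i) = B i.
Proof. by move=> iN; rewrite /rank index_at. Qed.

Lemma BS i : i < N -> B i.+1 = B i + pairs (at_ i).
Proof. by move=> iN; rewrite /B (take_nth v0) // -cats1 count_cat /= addn0. Qed.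

Lemma BN : B N = k. Proof. by rewrite /B take_size. Qed.

Lemma B_mono i j : i <= j -> j <= N -> B i <= B j.
Proof.
elim: j => [|j IH]; first by rewrite leqn0 => /eqP->.
rewrite leq_eqVlt => /orP[/eqP->//|ij] jN.
by rewrite BS //; apply: leq_trans (IH _ (ltnW jN)) (leq_addr _ _).
Qed.

Lemma B_pred : (B N.-1).+1 = k.
Proof. by rewrite -BN -{2}N1 BS ?N1 // pairs_last addn1. Qed.

Lemma B_lt i : i < N -> B i < k.
Proof. by move=> iN; rewrite -B_pred ltnS; apply: B_mono; rewrite -ltnS N1. Qed.

Lemma rank_lt v : rank v < k. Proof. exact: B_lt (index_lt v). Qed.

Lemma B_onto n j : n <= N -> j < B n -> exists i, [/\ i < n, pairs (at_ i) & B i = j].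
Proof.
elim: n => [|n IH] nN; first by rewrite /B take0.
rewrite BS //; case pn: (pairs (at_ n)); last first.
  by rewrite addn0 => /(IH (ltnW nN))[i [i1 i2 i3]]; exists i; rewrite ltnW.
rewrite addn1 ltnS leq_eqVlt => /orP[/eqP->|]; first by exists n.
by move/(IH (ltnW nN))=> [i [i1 i2 i3]]; exists i; rewrite ltnW.
Qed.

Lemma port_cases u :
  [/\ pairs (pi u), ~~ pairs (prev c (pi u)) & next c (pi u) = pi (mu u)] \/
  [/\ ~~ pairs (pi u), pairs (prev c (pi u)) & prev c (pi u) = pi (mu u)].
Proof.
have pn : next c (pi u) != prev c (pi u) by apply: next_neq_prev.
have prevE : pairs (prev c (pi u)) -> prev c (pi u) = pi (mu u).
  by case/existsP=> u' /andP[/eqP E]; rewrite next_prev // => /eqP/pi_inj uE; rewrite E uE muK.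
have nextE : pairs (pi u) -> next c (pi u) = pi (mu u).
  by case/existsP=> u' /andP[/eqP/pi_inj<- /eqP].
case: (mu_next u) => E.
  left; have p1 : pairs (pi u) by apply/existsP; exists u; rewrite eqxx E /=.
  by split=> //; apply: contra pn => /prevE->; rewrite E.
right; have E2 : prev c (pi u) = pi (mu u) by rewrite -E prev_next.
split=> //; first by apply: contra pn => /nextE->; rewrite E2.
by rewrite E2; apply/existsP; exists (mu u); rewrite eqxx E muK /=.
Qed.

Lemma step_cut_port v x : step_cut v x ->
  (exists u, v = pi u) /\ (exists u, next c v = pi u).
Proof.
by case/andP=> /existsP[u /andP[/eqP-> /eqP E]] _; split; [exists u | exists (mu u)].
Qed.

Lemma val_ord_pred (x : X) : ord_pred x = (if x == 0 :> nat then q.-1 else x.-1) :> nat.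
Proof.
have xq := ltn_ord x; rewrite /=; case: eqP => [->|x0].
  by rewrite add0n modn_small //; move: q_ge4; clear; lia.
have -> : (x + q).-1 = x.-1 + q by move: x0; clear; lia.
by rewrite modnDr modn_small //; move: xq; clear; lia.
Qed.

Lemma cut_exits u x : step_cut (pi u) x + step_cut (prev c (pi u)) x =
  exits q k (port_rank u) x.
Proof.
rewrite /step_cut /port_rank.
by case: (port_cases u) => -[h1 h2 _]; rewrite ?h1 ?h2 ?(negPf h1) ?(negPf h2) //= addn0.
Qed.

Lemma port_rank_lt u : port_rank u < k.
Proof. by rewrite /port_rank; case: ifP => _; apply: rank_lt. Qed.

Lemma step_cut_rem u x :
  step_cut (pi u) x + step_cut (prev c (pi u)) x = step_rem u x + step_rem u (ord_pred x) /\
  step_rem u x + step_rem u (ord_pred x) <= 1.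
Proof.
rewrite cut_exits /step_rem val_ord_pred.
by have [-> ?] := exits_removed q_ge4 qk (port_rank_lt u) (ltn_ord x).
Qed.

Let F := @leaf_factor V U q pi c step_cut step_rem.

Let Fsym : symmetric F. Proof. exact: leaf_factor_sym. Qed.

Let FC := sym_connect_sym Fsym.

Lemma block_connect i j x : i <= j -> j < N -> B i = B j ->
  connect F (inl (at_ i, x)) (inl (at_ j, x)).
Proof.
move: {2}(j - i) (erefl (j - i)) => n; elim: n i => [|n IH] i ji ij jN E.
  have -> : i = j by move: ji ij; clear; lia.
  exact: connect0.
have ij' : i < j by move: ji; clear; lia.
have iN : i < N by apply: ltn_trans jN.
have := B_mono ij' (ltnW jN); rewrite BS // -E.
case pi_: (pairs (at_ i)); first by clear; lia.
move=> _; have E' : B i.+1 = B j by rewrite BS // pi_ addn0.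
apply: connect_trans (IH i.+1 _ ij' jN E'); last by move: ji; clear; lia.
have -> : at_ i.+1 = next c (at_ i).
  by rewrite next_at //; case: eqP => // h; move: jN ij'; rewrite -h; clear; lia.
by apply: track; rewrite /step_cut pi_.
Qed.

Lemma same_block i j x : i < N -> j < N -> B i = B j ->
  connect F (inl (at_ i, x)) (inl (at_ j, x)).
Proof.
move=> iN jN E; case: (leqP i j) => ij; first exact: block_connect.
by rewrite FC; apply: block_connect => //; apply: ltnW.
Qed.

Lemma ring_single u (x y : X) : (port_rank u).+1 != k ->
  connect F (inr (u, x)) (inr (u, y)).
Proof.
move=> jk; set d := dom q k (port_rank u).
have remE (z : X) : step_rem u z = (z == d :> nat).
  by rewrite /step_rem /removed (negPf jk).
have dq : d.+1 < q by apply: dom_bound => //; rewrite ltn_neqAle jk port_rank_lt.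
have q0 : 0 < q by apply: leq_trans q_ge4.
pose o : X := Ordinal q0.
have q1 : q.-1 < q by rewrite prednK.
pose t : X := Ordinal q1.
have to : connect F (inr (u, t)) (inr (u, o)).
  apply: ring_wrap => //=; first by rewrite prednK.
  by rewrite remE /=; move: dq; clear; lia.
suff toO z : connect F (inr (u, z)) (inr (u, o)).
  by apply: connect_trans (toO x) _; rewrite FC.
case: (leqP z d) => zd.
  rewrite FC; apply: ring_arc => // w /andP[_ wz]; rewrite remE.
  by rewrite ltn_eqF //; apply: leq_trans wz zd.
apply: connect_trans to; apply: ring_arc => //=.
  by have := ltn_ord z; clear; lia.
by move=> w /andP[zw _]; rewrite remE gtn_eqF //; apply: leq_trans zd zw.
Qed.

Lemma ring_double u (x y : X) : (port_rank u).+1 = k ->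
  (nat_of_ord x \in [:: 1; 2]) = (nat_of_ord y \in [:: 1; 2]) ->
  connect F (inr (u, x)) (inr (u, y)).
Proof.
move=> jk.
have remE (z : X) : step_rem u z = (z == 0 :> nat) || (z == 2 :> nat).
  by rewrite /step_rem /removed jk eqxx.
have q0 : 0 < q by apply: leq_trans q_ge4.
pose o : X := Ordinal q0.
have q1 : q.-1 < q by rewrite prednK.
pose t : X := Ordinal q1.
have to : connect F (inr (u, t)) (inr (u, o)).
  apply: ring_wrap => //=; first by rewrite prednK.
  by rewrite remE /=; move: q_ge4; clear; lia.
have toO z : (nat_of_ord z \in [:: 1; 2]) = false -> connect F (inr (u, z)) (inr (u, o)).
  rewrite !inE => z12; have [z0|z0] := eqVneq (nat_of_ord z) 0.
    by have -> : z = o by apply: val_inj.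
  apply: connect_trans to; apply: ring_arc => //=.
    by have := ltn_ord z; clear; lia.
  by move=> w /andP[zw _]; rewrite remE; move: z12 z0 zw; clear; lia.
have o1q : 1 < q by apply: leq_trans q_ge4.
pose p : X := Ordinal o1q.
have toP z : (nat_of_ord z \in [:: 1; 2]) -> connect F (inr (u, p)) (inr (u, z)).
  rewrite !inE => z12; apply: ring_arc => /=; first by move: z12; clear; lia.
  by move=> w zw; rewrite remE; move: z12 zw; clear; lia.
case x12: (nat_of_ord x \in _) => /esym y12.
  by apply: connect_trans (toP y y12); rewrite FC; apply: toP.
by apply: connect_trans (toO x x12) _; rewrite FC; apply: toO.
Qed.

Lemma exit_connect u (x : X) : exits q k (port_rank u) x ->
  connect F (inl (pi u, x)) (inr (u, x)).
Proof.
move=> ex; apply: port_exit; have := cut_exits u x; rewrite ex.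
by do 2 case: (step_cut _ _).
Qed.

(** The predicate [M] for [ranks_connected]. There copies are natural numbers, hence the ordinal [y]
    with value [x]. *)
Definition main_block j x := forall i (y : X), i < N -> B i = j -> y = x :> nat ->
  connect F (inl (at_ 0, Ordinal (leq_trans (isT : 0 < 4) q_ge4))) (inl (at_ i, y)).

Lemma main_link i j (x y : X) : i < N -> j < N ->
  connect F (inl (at_ i, x)) (inl (at_ j, y)) ->
  (main_block (B i) x <-> main_block (B j) y).
Proof.
move=> iN jN ij; split=> h i' y' i'N E yy.
  have -> : y' = y by apply: val_inj.
  apply: connect_trans (same_block y jN i'N (esym E)).
  exact: connect_trans (h i x iN erefl erefl) ij.
have -> : y' = x by apply: val_inj.
apply: connect_trans (same_block x iN i'N (esym E)).
by apply: connect_trans (h j y jN erefl erefl) _; rewrite FC.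
Qed.

Lemma pair_ports j : j < k -> exists i u, [/\ i < N, B i = j, at_ i = pi u,
  next c (at_ i) = pi (mu u) & port_rank u = j /\ port_rank (mu u) = j].
Proof.
rewrite -BN => /(B_onto (leqnn N))[i [iN pi_ Bi]].
have /existsP[u /andP[/eqP Ei /eqP En]] := pi_.
exists i, u; split=> //; rewrite /port_rank -Ei pi_ rank_at //; split=> //.
have pE : prev c (pi (mu u)) = at_ i by rewrite -En prev_next.
rewrite pE rank_at // Bi; case: ifP => // p.
by case: (port_cases (mu u)) => -[h1 h2 _]; [rewrite pE pi_ in h2 | rewrite p in h1].
Qed.

Lemma step_connected a b : connect F a b.
Proof.
have q0 : 0 < q := leq_trans (isT : 0 < 4) q_ge4.
have link u j (x y : X) : port_rank u = j -> exits q k j x -> exits q k j y ->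
    connect F (inr (u, x)) (inr (u, y)) -> connect F (inl (pi u, x)) (inl (pi u, y)).
  move=> uj ex ey xy; rewrite -uj in ex ey.
  apply: connect_trans (exit_connect ex) _; apply: connect_trans xy _.
  by rewrite FC; apply: exit_connect.
have nextE i : i < N -> i.+1 < N -> next c (at_ i) = at_ i.+1.
  by move=> iN iN1; rewrite next_at // ltn_eqF.
have B0 : B 0 = 0 by rewrite /B take0.
have k0 : 0 < k by apply: leq_trans qk.
have Bk : B N.-1 = k.-1 by have := B_pred; clear; lia.
have N1N : N.-1 < N by rewrite N1.
have next_last : next c (at_ N.-1) = at_ 0 by rewrite next_at ?N1 ?eqxx.
have succ i j : i < N -> B i = j -> pairs (at_ i) -> j.+1 < k -> i.+1 < N /\ B i.+1 = j.+1.
  move=> iN Bi pi_ jk; have Bi1 : B i.+1 = j.+1 by rewrite BS // pi_ Bi addn1.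
  split=> //; rewrite ltn_neqAle iN andbT; apply/eqP=> E.
  by move: Bi1 jk; rewrite E BN; clear; lia.
have pairsP i u : at_ i = pi u -> next c (at_ i) = pi (mu u) -> pairs (at_ i).
  by move=> E1 E2; apply/existsP; exists u; rewrite E2 {1}E1 !eqxx.
have lastP' : exists u, [/\ at_ N.-1 = pi u, at_ 0 = pi (mu u),
    port_rank u = k.-1 & port_rank (mu u) = k.-1].
  have [|i [u [iN Bi E1 E2 [r1 r2]]]] := @pair_ports k.-1.
    by rewrite prednK.
  have iE : i = N.-1.
    apply/eqP; rewrite eqn_leq -ltnS N1 iN /= leqNgt; apply/negP=> iN1.
    have := B_mono iN1 (ltnW N1N); rewrite BS // (pairsP i u) // Bi Bk; clear; lia.
  by exists u; rewrite -iE -next_last -iE.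
have dd j : j.+1 < k -> exits q k j (dom q k j) /\ exits q k j (dom q k j).+1.
  by move=> jk; rewrite /exits (ltn_eqF jk) !eqxx orbT.
have ex4 x : x < 4 -> exits q k k.-1 x by move=> x4; rewrite /exits prednK // eqxx.
have main : forall j x, j < k -> x < q -> main_block j x.
  apply: (ranks_connected q_ge4 q_even k_even qk).
  - move=> j x jk xq nex; have [i [u [iN Bi E1 E2 _]]] := pair_ports (ltnW jk).
    have [iN1 Bi1] := succ i j iN Bi (pairsP i u E1 E2) jk.
    rewrite -Bi1 -[in X in X <-> _]Bi; apply: (main_link (x := Ordinal xq) (y := Ordinal xq)) => //.
    by rewrite -nextE //; apply: track; rewrite /step_cut rank_at // Bi negb_and nex orbT.
  - move=> x xq nex; rewrite -B0 -Bk.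
    apply: (main_link (x := Ordinal xq) (y := Ordinal xq)) => //.
    by rewrite -next_last; apply: track; rewrite /step_cut rank_at // Bk negb_and nex orbT.
  - move=> j jk; have dq := dom_bound q_ge4 qk jk.
    have [i [u [iN Bi E1 E2 [r1 r2]]]] := pair_ports (ltnW jk); have [d1 d2] := dd j jk.
    rewrite -{1 3}Bi; apply: (main_link (x := Ordinal (ltnW dq)) (y := Ordinal dq)) => //.
    rewrite E1; apply: (link u j) => //.
    by apply: ring_single; rewrite r1 ltn_eqF.
  - move=> j jk; have dq := dom_bound q_ge4 qk jk.
    have [i [u [iN Bi E1 E2 [r1 r2]]]] := pair_ports (ltnW jk); have [d1 d2] := dd j jk.
    have [iN1 Bi1] := succ i j iN Bi (pairsP i u E1 E2) jk.
    rewrite -{1 2}Bi1; apply: (main_link (x := Ordinal (ltnW dq)) (y := Ordinal dq)) => //.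
    rewrite -nextE // E2; apply: (link (mu u) j) => //.
    by apply: ring_single; rewrite r2 ltn_eqF.
  - have [u [E1 _ r1 _]] := lastP'; rewrite -Bk.
    apply: (main_link (i := N.-1) (j := N.-1) (x := Ordinal (leq_trans (isT : 1 < 4) q_ge4))
      (y := Ordinal (leq_trans (isT : 2 < 4) q_ge4))) => //.
    rewrite E1; apply: (link u k.-1); rewrite ?ex4 //.
    by apply: ring_double; rewrite // r1 prednK.
  - have [u [E1 _ r1 _]] := lastP'; rewrite -Bk.
    apply: (main_link (i := N.-1) (j := N.-1) (x := Ordinal (leq_trans (isT : 3 < 4) q_ge4))
      (y := Ordinal (leq_trans (isT : 0 < 4) q_ge4))) => //.
    rewrite E1; apply: (link u k.-1); rewrite ?ex4 //.
    by apply: ring_double; rewrite // r1 prednK.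
  - have [u [_ E2 _ r2]] := lastP'; rewrite -{1 3}B0.
    apply: (main_link (i := 0) (j := 0) (x := Ordinal (leq_trans (isT : 1 < 4) q_ge4))
      (y := Ordinal (leq_trans (isT : 2 < 4) q_ge4))) => //.
    rewrite E2; apply: (link (mu u) k.-1); rewrite ?ex4 //.
    by apply: ring_double; rewrite // r2 prednK.
  - have [u [_ E2 _ r2]] := lastP'; rewrite -{1 3}B0.
    apply: (main_link (i := 0) (j := 0) (x := Ordinal (leq_trans (isT : 3 < 4) q_ge4))
      (y := Ordinal (leq_trans (isT : 0 < 4) q_ge4))) => //.
    rewrite E2; apply: (link (mu u) k.-1); rewrite ?ex4 //.
    by apply: ring_double; rewrite // r2 prednK.
  - move=> i y iN Bi y0; have -> : y = Ordinal (leq_trans (isT : 0 < 4) q_ge4).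
      exact: val_inj.
    by apply: same_block; rewrite // Bi B0.
rewrite /main_block in main; set root := inl (at_ 0, _) in main.
have mainV v x : connect F root (inl (v, x)).
  rewrite -(at_index v); apply: (main (B (index v c)) x) => //.
    exact/B_lt/index_lt.
  exact: index_lt.
have mainU u x : connect F root (inr (u, x)).
  suff [y [ey xy]] : exists y : X, exits q k (port_rank u) y /\
      connect F (inr (u, y)) (inr (u, x)).
    apply: connect_trans (mainV (pi u) y) _.
    exact: connect_trans (exit_connect ey) xy.
  have [E|E] := eqVneq (port_rank u).+1 k; last first.
    have jk : (port_rank u).+1 < k by rewrite ltn_neqAle E port_rank_lt.
    have [d1 _] := dd _ jk.
    exists (Ordinal (ltnW (dom_bound q_ge4 qk jk))); split=> //.
    exact: ring_single.
  have pk : port_rank u = k.-1 by rewrite -E.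
  case x12: (nat_of_ord x \in [:: 1; 2]).
    exists (Ordinal (leq_trans (isT : 1 < 4) q_ge4)); rewrite pk ex4 //; split=> //.
    by apply: ring_double; rewrite // x12.
  exists (Ordinal (leq_trans (isT : 0 < 4) q_ge4)); rewrite pk ex4 //; split=> //.
  by apply: ring_double; rewrite // x12.
by apply: (@connect_trans _ _ root); [rewrite FC; case: a | case: b] => -[].
Qed.

Lemma pairs_mu u : pairs (pi (mu u)) = ~~ pairs (pi u).
Proof.
case: (port_cases u) => -[h1 h2 E].
  have p : pairs (prev c (pi (mu u))) by rewrite -E prev_next.
  by rewrite h1; case: (port_cases (mu u)) => -[h3 h4 _]; [rewrite p in h4 | exact: negPf].
by rewrite -E h2 h1.
Qed.

Lemma card_pairs : k.*2 = #|U|.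
Proof.
pose S := [set u | pairs (pi u)].
have -> : k = #|S|.
  rewrite /k -size_filter -(card_imset _ pi_inj).
  have /card_uniqP <- : uniq (filter pairs c) by rewrite filter_uniq.
  apply: eq_card => v; rewrite mem_filter call andbT.
  apply/idP/imsetP => [pv|[u]]; last by rewrite inE => pu ->.
  have /existsP[u /andP[/eqP E _]] := pv.
  by exists u; rewrite // inE -E.
have Sc : mu @: S = ~: S.
  apply/setP=> u; rewrite inE; apply/imsetP/idP => [[w]|]; rewrite inE.
    by move=> pw ->; rewrite inE pairs_mu pw.
  by move=> nu; exists (mu u); rewrite ?muK // inE pairs_mu.
by rewrite -addnn -{2}(card_imset _ (can_inj muK)) Sc cardsC.
Qed.

(** At the last pair the removed positions 0 and 2 are both even, as [leaf_matching] demands of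
    positions in one ring. *)
Definition port_parity u := if (port_rank u).+1 == k then false else odd (dom q k (port_rank u)).

Lemma step_leaf : exists c' mu',
  [/\ cycle (@leaf_adj V U q eV pi) c', uniq c', forall a, a \in c', 2 < size c'
    & involutive mu' /\ forall w,
      next c' (inr w) = inr (mu' w) \/ next c' (inr (mu' w)) = inr w].
Proof.
have q2 : 2 < q by apply: ltnW.
have q0 : 0 < q := leq_trans (isT : 0 < 4) q_ge4.
have [c' [c1 c2 c3 c4 c5]] := leaf_cycle q2 eV_sym pi_inj cc uc call sc
  step_cut_port step_cut_rem (inl (v0, Ordinal q0)) step_connected.
have [||mu' [m1 m2]] := @leaf_matching V U q step_rem c' port_parity q_even.
- move=> u x; rewrite /step_rem /removed /port_parity; case: eqP => _.
    by case/orP=> /eqP->.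
  by move/eqP->.
- exact: c5.
by exists c', mu'.
Qed.

End Step.

Lemma leaf_step (V U : finType) q (eV : rel V) (pi : U -> V) c mu n :
  4 <= q -> ~~ odd q -> symmetric eV -> injective pi -> cycle eV c -> uniq c ->
  (forall v, v \in c) -> 2 < size c -> involutive mu ->
  (forall u, next c (pi u) = pi (mu u) \/ next c (pi (mu u)) = pi u) ->
  #|U| = q ^ n.+2 ->
  exists c' mu', [/\ cycle (@leaf_adj V U q eV pi) c', uniq c', forall a, a \in c',
    2 < size c' & involutive mu' /\ forall w,
      next c' (inr w) = inr (mu' w) \/ next c' (inr (mu' w)) = inr w].
Proof.
move=> q4 qe eVs pii cc uc call sc muK mun cU.
have U0 : 0 < #|U| by rewrite cU expn_gt0; move: q4; clear; case: q.
have /card_gt0P[u0 _] := U0.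
have [v pv] : exists v, pairs pi c mu v.
  have [[p _ _]|[_ p _]] := port_cases pii uc call sc muK mun u0; by eexists; exact: p.
have [i s E] := rot_to (call v).
(* The second rotation moves [v], the first vertex of a pair, to the end of the list, as
   [pairs_last] asks. *)
pose d := rot 1 (rot i c).
have dE : d = rcons s v by rewrite /d E rot1_cons.
have ud : uniq d by rewrite /d !rot_uniq.
have nd w : next d w = next c w by rewrite /d !next_rot ?rot_uniq.
have dmem w : w \in d by rewrite /d !mem_rot.
have szd : size d = size c by rewrite /d !size_rot.
have dc : cycle eV d by rewrite /d !rot_cycle.
have pd w : pairs pi d mu w = pairs pi c mu w.
  by apply: eq_existsb => u; rewrite nd.
have mud u : next d (pi u) = pi (mu u) \/ next d (pi (mu u)) = pi u by rewrite !nd.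
have sd : 2 < size d by rewrite szd.
have k2 := card_pairs pii ud dmem sd muK mud.
have qh : q = q./2.*2 by rewrite even_halfK.
(* Half of [q ^ n.+2], written as a multiple of [q]: hence even and at least [q]. *)
have kE : count (pairs pi d mu) d = (q./2 * q ^ n) * q.
  by apply/double_inj; rewrite k2 cU !expnS !doubleMl -qh mulnC.
apply: (step_leaf (v0 := v) q4 qe eVs pii dc ud dmem sd muK mud).
- by rewrite pd dE size_rcons /= nth_rcons ltnn eqxx.
- by rewrite kE oddM (negPf qe) andbF.
- rewrite kE leq_pmull // muln_gt0 half_gt0 expn_gt0; move: q4; clear; lia.
Qed.

(** * Path exponents *)

Section Encoding.
Variables (G K : sgraph) (q : nat) (g : 'I_q -> G) (g0 : G).
Hypotheses (q_ge4 : 4 <= q) (q_even : ~~ odd q) (g_inj : injective g)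
  (g_onto : forall a, exists x, a = g x)
  (g_adj : forall x, adj (g x) (g (ordS x))).

Notation vert := (exp_vertex G K).
Implicit Types f : {ffun K -> G}.

Definition upd (f : {ffun K -> G}) (w : K) (a : G) : {ffun K -> G} :=
  [ffun i => if i == w then a else f i].

Lemma upd_same f w a : upd f w a w = a.
Proof. by rewrite ffunE eqxx. Qed.

Lemma upd_other f w a i : i != w -> upd f w a i = f i.
Proof. by rewrite ffunE => /negPf->. Qed.

Lemma upd_eq f w a : a = f w -> upd f w a = f.
Proof. by move=> ->; apply/ffunP=> i; rewrite ffunE; case: eqP => [->|]. Qed.

Lemma upd_upd f w a b : upd (upd f w a) w b = upd f w b.
Proof. by apply/ffunP=> i; rewrite !ffunE; case: eqP. Qed.

Lemma upd_inj f f' w a b : f w = f' w -> upd f w a = upd f' w b -> f = f' /\ a = b.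
Proof.
move=> fw /ffunP E; split; last by have := E w; rewrite !upd_same.
apply/ffunP=> i; have [->//|iw] := eqVneq i w.
by have := E i; rewrite !upd_other.
Qed.

Lemma exp_adj_upd (a b : vert) w z : a.2 != w -> exp_adj a b ->
  exp_adj (upd a.1 w z, a.2) (upd b.1 w z, b.2).
Proof.
case: a b => [f i] [f' j]; rewrite /exp_adj /= => iw.
case/orP=> /and3P[ij aij /forallP h]; apply/orP; [left|right]; rewrite ij.
  rewrite !upd_other // aij; apply/forallP=> l; rewrite !ffunE.
  by case: (l == w); rewrite ?eqxx ?implybT ?h.
by rewrite aij; apply/forallP=> l; rewrite !ffunE; case: (l == w); rewrite ?eqxx ?h.
Qed.

Lemma exp_adj_ring f w x y : ring_adj x y ->
  exp_adj (upd f w (g x), w) (upd f w (g y), w).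
Proof.
move=> xy; rewrite /exp_adj /= eqxx !upd_same.
have -> : adj (g x) (g y).
  by case/orP: xy => /eqP->; rewrite ?g_adj // adj_sym g_adj.
by apply/orP; left; apply/forallP=> l; apply/implyP=> lw; rewrite !upd_other.
Qed.

Lemma exp_adj_switch f (w w' : K) : adj w w' -> exp_adj (f, w) (f, w').
Proof.
move=> ww'; rewrite /exp_adj /= ww'.
have -> : w != w' by apply: contraTneq ww' => ->; rewrite adj_irrefl.
by apply/orP; right; apply/forallP=> l.
Qed.

(* [phi] identifies [V] with the vertices of the exponential graph whose second
   component is on the path [h], the first components being [g0] outside [h];
   [pi] enumerates those sitting at the last vertex [w] of [h]. *)
Record encoding (h : seq K) (w : K) (V U : finType) (eV : rel V) (pi : U -> V)
    (phi : V -> vert) : Prop := Encoding {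
  enc_sym : symmetric eV;
  enc_pi : injective pi;
  enc_inj : injective phi;
  enc_hom : forall a b, eV a b -> exp_adj (phi a) (phi b);
  enc_mem : forall v, (phi v).2 \in h;
  enc_off : forall v i, i \notin h -> (phi v).1 i = g0;
  enc_onto : forall f j, j \in h -> (forall i, i \notin h -> f i = g0) ->
    exists v, phi v = (f, j);
  enc_port : forall v, (phi v).2 = w <-> exists u, v = pi u }.

Lemma encoding_base w : encoding [:: w] w (@ring_adj q) (@id 'I_q)
  (fun x => (upd [ffun=> g0] w (g x), w)).
Proof.
split=> //.
- exact: ring_adj_sym.
- by move=> x y [/upd_inj[]]; rewrite // => _ /g_inj.
- by move=> x y; apply: exp_adj_ring.
- by move=> v; rewrite inE.
- by move=> v i; rewrite inE => iw; rewrite upd_other // ffunE.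
- move=> f j; rewrite inE => /eqP-> off; have [x fx] := g_onto (f w); exists x.
  congr pair; apply/ffunP=> i; rewrite !ffunE; case: eqP => [->//|/eqP iw].
  by rewrite off // inE.
- by move=> v; split=> // _; exists v.
Qed.

(** Copy [x] fixes the coordinate at [w'] to [g x]; a new ring lets this coordinate vary while the
    second component is [w']. *)
Lemma encoding_step h w w' (V U : finType) (eV : rel V) (pi : U -> V) phi :
  w \in h -> w' \notin h -> adj w w' -> encoding h w eV pi phi ->
  encoding (rcons h w') w' (@leaf_adj V U q eV pi)
    (@inr (V * 'I_q)%type (U * 'I_q)%type)
    (fun a => match a with
      | inl (v, x) => (upd (phi v).1 w' (g x), (phi v).2)
      | inr (u, x) => (upd (phi (pi u)).1 w' (g x), w') end).
Proof.
move=> wh w'h ww' [Es Ep Ei Eh Em Eo Ef Et].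
have nw v : (phi v).2 != w' by apply: contraNneq w'h => <-.
have piw u : (phi (pi u)).2 = w by apply/Et; exists u.
have w0 v : (phi v).1 w' = g0 by apply: Eo.
have inj1 v v' x y : upd (phi v).1 w' (g x) = upd (phi v').1 w' (g y) ->
    (phi v).2 = (phi v').2 -> v = v' /\ x = y.
  move=> /upd_inj; rewrite !w0 => /(_ erefl)[E1 /g_inj->] E2; split=> //.
  by apply: Ei; case: (phi v) (phi v') E1 E2 => ? ? [? ?] /= -> ->.
split.
- move=> [[v x]|[u x]] [[v' y]|[u' y]] //=; rewrite eq_sym //.
    by rewrite Es.
  by rewrite orbC.
- by move=> a b [].
- move=> [[v x]|[u x]] [[v' y]|[u' y]] [].
  + by move=> /inj1 h1 /h1[-> ->].
  + by move=> _ E; have := nw v; rewrite E eqxx.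
  + by move=> _ E; have := nw v'; rewrite -E eqxx.
  + by move=> /inj1; rewrite !piw => /(_ erefl)[/Ep-> ->].
- have sw v u x : v = pi u -> exp_adj (upd (phi v).1 w' (g x), (phi v).2)
      (upd (phi (pi u)).1 w' (g x), w').
    by move=> ->; rewrite piw; apply: exp_adj_switch.
  move=> [[v x]|[u x]] [[v' y]|[u' y]] /= /andP[/eqP<-].
  + by move=> /Eh; apply: exp_adj_upd.
  + by move=> /eqP; apply: sw.
  + by move=> /eqP; rewrite exp_adj_sym; apply: sw.
  + exact: exp_adj_ring.
- by move=> [[v x]|[u x]] /=; rewrite mem_rcons inE ?eqxx // Em orbT.
- by move=> [[v x]|[u x]] i /=; rewrite mem_rcons inE negb_or => /andP[iw ih];
    rewrite upd_other // Eo.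
- move=> f j; rewrite mem_rcons inE => jh off.
  have [x fx] := g_onto (f w').
  have off' i : i \notin h -> upd f w' g0 i = g0.
    have [->|iw] := eqVneq i w'; first by rewrite upd_same.
    by move=> ih; rewrite upd_other // off // mem_rcons inE negb_or iw.
  have [E|jw] := eqVneq j w'.
    have [v vE] := Ef _ _ wh off'.
    have [u uE] : exists u, v = pi u by apply/Et; rewrite vE.
    exists (inr (u, x)); rewrite -uE vE /= upd_upd upd_eq ?E //.
  rewrite (negPf jw) /= in jh; have [v vE] := Ef _ _ jh off'.
  by exists (inl (v, x)); rewrite vE /= upd_upd upd_eq.
- move=> [[v x]|[u x]] /=; split=> //.
  + by move=> E; have := nw v; rewrite E eqxx.
  + by case.
  + by move=> _; exists (u, x).
Qed.

(** The path grows at its last vertex, over which the ports sit. Two vertices to start with give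
    [q ^ 2] ports, and each leaf multiplies their number by [q]. *)
Lemma path_tower s w0 w1 : uniq [:: w0, w1 & s] -> path (@adj K) w0 (w1 :: s) ->
  exists (V U : finType) (eV : rel V) (pi : U -> V) phi c mu,
  [/\ encoding [:: w0, w1 & s] (last w1 s) eV pi phi,
      [/\ cycle eV c, uniq c, forall v, v \in c & 2 < size c],
      involutive mu,
      forall u, next c (pi u) = pi (mu u) \/ next c (pi (mu u)) = pi u
    & #|U| = q ^ (size s).+2].
Proof.
elim/last_ind: s => [|s w IH] us ps.
  have [c [mu [c1 c2 c3 c4 [m1 m2]]]] := ring_leaf (ltnW q_ge4) q_even.
  do 4 eexists; eexists; exists c, mu; split; last by rewrite card_prod card_ord.
  - have := encoding_step (mem_head w0 [::]) _ _ (encoding_base w0); apply.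
      by move: us; rewrite /= !inE andbT eq_sym.
    by move: ps; rewrite /= andbT.
  - by split.
  - exact: m1.
  - exact: m2.
move: us ps; rewrite -!rcons_cons rcons_uniq => /andP[ws us].
rewrite rcons_path => /andP[ps aw].
have [V [U [eV [pi [phi [c [mu [enc [cc uc call sc] muK mun cU]]]]]]]] := IH us ps.
have [c' [mu' [c1 c2 c3 c4 [m1 m2]]]] :=
  leaf_step q_ge4 q_even (enc_sym enc) (enc_pi enc) cc uc call sc muK mun cU.
do 4 eexists; eexists; exists c', mu'; split.
- rewrite last_rcons; have := encoding_step _ ws aw enc; apply.
  by rewrite /= inE mem_last orbT.
- by split.
- exact: m1.
- exact: m2.
- by rewrite card_prod cU card_ord size_rcons mulnC expnS.
Qed.

Lemma encoding_hamiltonian h w (V U : finType) (eV : rel V) (pi : U -> V) phi c :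
  (forall i, i \in h) -> encoding h w eV pi phi -> cycle eV c -> uniq c ->
  (forall v, v \in c) -> 2 < size c -> hamiltonian (exp_graph G K).
Proof.
move=> hall enc cc uc call sc; exists (map phi c); split; first by rewrite size_map.
  rewrite /ucycle map_inj_uniq ?uc; last exact: enc_inj enc.
  rewrite andbT cycle_map; apply: sub_cycle cc => a b; exact: enc_hom enc a b.
case=> f j; have [i|v <-] := enc_onto enc (hall j) (f := f); first by rewrite hall.
exact: map_f.
Qed.

Lemma exp_path_hamiltonian w0 s : uniq (w0 :: s) -> path (@adj K) w0 s ->
  (forall i, i \in w0 :: s) -> hamiltonian (exp_graph G K).
Proof.
case: s => [|w1 s] us ps all.
  have [c [cc uc call sc _]] := ring_cycle (ltnW q_ge4).
  exact: encoding_hamiltonian all (encoding_base w0) cc uc call sc.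
have [V [U [eV [pi [phi [c [mu [enc [cc uc call sc] _ _ _]]]]]]]] := path_tower us ps.
exact: encoding_hamiltonian all enc cc uc call sc.
Qed.

End Encoding.

Lemma exp_hamiltonian (G K : sgraph) w0 s : even_graph G -> hamiltonian G ->
  uniq (w0 :: s) -> path (@adj K) w0 s -> (forall i, i \in w0 :: s) ->
  hamiltonian (exp_graph G K).
Proof.
move=> Ge [c [sc /andP[cc uc] call]] us ps all.
have qG : size c = #|G|.
  by have /card_uniqP <- := uc; apply: eq_card => x; rewrite call.
have qe : ~~ odd (size c) by rewrite qG.
have q4 : 4 <= size c.
  by move: sc; rewrite leq_eqVlt => /orP[/eqP E|//]; rewrite -E in qe.
have /card_gt0P[g0 _] := vertex_gt0 G.
pose g (x : 'I_(size c)) := nth g0 c x.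
apply: (@exp_path_hamiltonian G K (size c) g g0) us ps all => //.
- by move=> x y /eqP; rewrite nth_uniq // => /eqP/val_inj.
- move=> a; have ac : index a c < size c by rewrite index_mem.
  by exists (Ordinal ac); rewrite /g nth_index.
- move=> x; rewrite /g val_ordS -next_nth_uniq //.
  exact: next_cycle.
Qed.

(** * Squares and cubes *)

Lemma conn_setT (H : sgraph) : connected H -> conn (@adj H) setT.
Proof.
move=> /forall_inP h x y xS yS; have /forall_inP/(_ y yS) := h x xS.
by [].
Qed.

Lemma two_connected_biconn (H : sgraph) : two_connected H -> biconn (@adj H) setT.
Proof.
rewrite /two_connected /connectivity; case: ex_minnP => m _ min m2.
have nd (S : {set H}) : #|S| < 2 -> ~~ disconnecting S.
  move=> S2; apply/negP=> dS; have := min #|S|; rewrite leqNgt (leq_trans S2 m2).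
  by move=> /(_ _)/negP[] //; apply/existsP; exists S; rewrite dS eqxx.
have cn (S : {set H}) : #|S| < 2 -> conn (@adj H) (~: S) /\ #|~: S| != 1.
  move=> /nd; rewrite negb_or negbK => /andP[/forall_inP h ->]; split=> // x y xS yS.
  by have /forall_inP/(_ y yS) := h x xS.
have [c0 n0] : conn (@adj H) setT /\ #|[set: H]| != 1.
  by rewrite -setC0; apply: cn; rewrite cards0.
have cv v : conn (@adj H) ([set: H] :\ v) /\ #|[set: H] :\ v| != 1.
  by rewrite setTD; apply: cn; rewrite cards1.
split=> //; last by move=> v _; have [] := cv v.
have /card_gt0P[v _] := vertex_gt0 H.
(* A graph with two vertices is excluded because deleting [v] would leave one vertex. *)
have [_] := cv v; move: n0; rewrite (cardsD1 v) inE.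
by case: #|_| => [|[|n]].
Qed.

Lemma sq_power_path (H : sgraph) x (s : seq H) : path (sq (@adj H) setT) x s ->
  uniq (x :: s) -> path (@power_adj H 2) x s.
Proof.
elim: s x => //= y s IH x /andP[xy ys] /andP[]; rewrite inE negb_or => /andP[nxy _] us.
apply/andP; split; last exact: IH.
case/orP: xy => [xy|/existsP[w /and3P[_ xw wy]]].
  by apply: (@power_adj_walk H 2 x [:: y]); rewrite //= xy.
by apply: (@power_adj_walk H 2 x [:: w; y]); rewrite //= xw wy.
Qed.

Theorem corollary6 (G H : sgraph) (G_even : even_graph G)
    (G_ham : hamiltonian G) :
  (two_connected H -> hamiltonian (exp_graph G (power_graph H 2))) /\
  (connected H -> hamiltonian (exp_graph G (power_graph H 3))).
Proof.
have /card_gt0P[x _] := vertex_gt0 H.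
split=> cH.
  have [t [t0 st xt _ pe]] := fleischner (@adj_sym H) (leqnn _)
    (two_connected_biconn cH) (in_setT x).
  have us : uniq (x :: t) by rewrite (perm_uniq pe) enum_uniq.
  have ps : path (@power_adj H 2) x t.
    apply: sq_power_path us; case: (t) t0 st xt => //= y p _ -> xy.
    by rewrite /sq /= xy.
  apply: (exp_hamiltonian (K := power_graph H 2)) G_even G_ham us ps _.
  by move=> i; rewrite (perm_mem pe) mem_enum in_setT.
have [s [pe ps _]] := cube_path (leqnn _) (conn_setT cH) (in_setT x).
apply: (exp_hamiltonian (K := power_graph H 3)) G_even G_ham _ ps _.
  by rewrite (perm_uniq pe) enum_uniq.
by move=> i; rewrite (perm_mem pe) mem_enum in_setT.
Qed.
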